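(* Let $(\Omega,\mu,(g_t)_{t\in\mathbb{R}})$ be a measure preserving dynamical system, where $\Omega$ is an $(n,d)$-dimensional tori bundle over $(M,\mathcal{A})$ with projection $\pi$ and trivializations $\psi_U$, $\mu$ is a compatible probability measure, and $(g_t)_{t\in\mathbb{R}}$ is a compatible flow with velocities $v_U$. For $\xi\in\mathbb{Z}^d\setminus\{0\}$ and $U\in\mathcal{A}$ let $m_{\xi,U}$ be the push-forward of $(\mu_\pi)_{|U}$ under $U\to\mathbb{R}$, $x\mapsto\langle\xi|v_U(x)\rangle$. Then the system exhibits Keplerian shear if and only if, for all charts $U\in\mathcal{A}$ and all nonzero $\xi\in\mathbb{Z}^d$, the measure $(m_{\xi,U})_{|\mathbb{R}^*}$ is Rajchman, where $\mathbb{R}^*=\mathbb{R}\setminus\{0\}$.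
   Context: $\mathbb{T}=\mathbb{R}/\mathbb{Z}$, $\lambda$ is Lebesgue (Haar) measure on $\mathbb{T}^d$, $\langle\cdot|\cdot\rangle$ is the Euclidean inner product on $\mathbb{R}^d$. Tori bundle: $M$ is an $n$-dimensional Lindelöf $\mathcal{C}^1$ manifold with atlas $\mathcal{A}$ (whose elements are identified with their chart domains $U\subset M$), $d\geq 1$, $\Omega$ is a topological space with its Borel $\sigma$-algebra and a Borel probability measure $\mu$, and $\pi:\Omega\to M$ is a continuous projection. $\Omega$ is an $(n,d)$-dimensional tori bundle if for each chart $U\in\mathcal{A}$ there is a homeomorphism $\psi_U:\pi^{-1}(U)\to U\times\mathbb{T}^d$ with $\pi_1\circ\psi_U=\pi_{|\pi^{-1}(U)}$, where $\pi_1$ is the projection on the first coordinate. Compatible measure: $\mu_\pi$ denotes the push-forward of $\mu$ by $\pi$; $\mu$ is compatible if for every $U\in\mathcal{A}$ the push-forward of $\mu_{|\pi^{-1}(U)}$ by $\psi_U$ equals $(\mu_\pi)_{|U}\otimes\lambda$. Compatible flow: for every $U\in\mathcal{A}$ there is a measurable $v_U:U\to\mathbb{R}^d$ such that for all $t\in\mathbb{R}$, $\psi_U\circ g_t\circ\psi_U^{-1}(x,y)=(x,y+tv_U(x))$ for $(x,y)\in U\times\mathbb{T}^d$. Invariant $\sigma$-algebra: $\mathcal{I}=\{A\text{ measurable}:\forall t\in\mathbb{R},\ \mu(A\,\Delta\, g_t^{-1}(A))=0\}$. Keplerian shear: for all $f\in L^2_\mu(\Omega)$, $f\circ g_t\rightharpoonup\mathbb{E}_\mu(f|\mathcal{I})$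 weakly in $L^2_\mu(\Omega)$ as $t\to+\infty$. Rajchman: a finite Borel measure $\nu$ on $\mathbb{R}$ is Rajchman if $\hat\nu(t)=\int_{\mathbb{R}}e^{2i\pi tx}\,d\nu(x)\to0$ as $t\to\pm\infty$. *)

(* Defs.v *)
From HB Require Import structures.
From mathcomp Require Import all_boot all_order all_algebra.
From mathcomp Require Import generic_quotient ring_quotient archimedean complex.
From mathcomp Require Import all_classical all_reals all_analysis.

Set Implicit Arguments.
Unset Strict Implicit.
Unset Printing Implicit Defensive.

Import Order.TTheory GRing.Theory Num.Theory.
Import numFieldNormedType.Exports.

Local Open Scope classical_set_scope.
Local Open Scope ring_scope.

Definition lindelof (T : topologicalType) : Prop :=
  forall F : set (set T), F `<=` open -> \bigcup_(U in F) U = setT ->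
  exists G : set (set T),
    [/\ G `<=` F, countable G & \bigcup_(U in G) U = setT].

(* [f] and [g] are total functions; only their values on [A] and [B] matter. *)
Definition homeo_between (X Y : topologicalType) (A : set X) (B : set Y)
    (f : X -> Y) (g : Y -> X) : Prop :=
  [/\ set_fun A B f, set_fun B A g, {in A, cancel f g}, {in B, cancel g f} &
      {within A, continuous f} /\ {within B, continuous g}].

(* The Borel sigma-algebra; [borel T] is an alias of the type [T]. *)
Notation borel T := (g_sigma_algebraType (@open T)).

Lemma open_borel (T : ptopologicalType) (U : set T) :
  open U -> measurable (U : set (borel T)).
Proof. by move=> oU; apply: sub_sigma_algebra. Qed.

Lemma continuous_borel (X Y : ptopologicalType) (f : X -> Y) :
  continuous f -> measurable_fun setT (f : borel X -> borel Y).
Proof.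
move=> /continuousP cf; apply: (@measurability _ _ (borel X) (borel Y) setT f (@open Y)) => //.
by move=> _ [V oV <-]; rewrite setTI; apply: open_borel; exact: cf.
Qed.

Lemma continuous_borelR (R : realType) (X : ptopologicalType) (f : X -> R) :
  continuous f -> measurable_fun setT (f : borel X -> measurableTypeR R).
Proof.
move=> /continuousP cf; apply: (measurability _ (measurable_realfun.RGenOpens.measurableE R)).
by move=> _ [_ [a [b ->] <-]]; rewrite setTI; apply: open_borel;
exact/cf/interval_open.
Qed.

Definition integers (R : realType) : {pred R} := fun x => x \is a Num.int.
Arguments integers R : clear implicits.

Fact integers_zmod_closed (R : realType) : zmod_closed (integers R).
Proof. by split=> [|x y]; [exact: rpred0 | exact: rpredB]. Qed.

HB.instance Definition _ (R : realType) :=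
  GRing.isZmodClosed.Build R (integers R) (integers_zmod_closed R).

(* [R/Z], with the quotient topology and the quotient group law. *)
Definition circle (R : realType) : Type :=
  quotient_topology (Quotient.quot (integers R)).

HB.instance Definition _ (R : realType) := PointedTopological.on (circle R).
HB.instance Definition _ (R : realType) := Quotient.on (circle R).
HB.instance Definition _ (R : realType) := GRing.isZmodule.Build (circle R)
  (@Quotient.addqA R (integers R)) (@Quotient.addqC R (integers R))
  (@Quotient.add0q R (integers R)) (@Quotient.addNq R (integers R)).

Definition toCircle (R : realType) (x : R) : circle R := (\pi_(circle R) x)%qT.

Lemma toCircleD (R : realType) : {morph @toCircle R : x y / x + y}.
Proof. by move=> x y; exact: (@Quotient.pi_add R (integers R)). Qed.

Lemma toCircle_eqP (R : realType) (x y : R) :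
  reflect (toCircle x = toCircle y) (x - y \is a Num.int).
Proof.
have E := @Quotient.idealrBE R (integers R) x y.
apply: (iffP idP) => h.
  by move: h => /(etrans (esym E)) /eqP.
by apply: (etrans E); apply/eqP.
Qed.

Notation torus R d := 'rV[circle R]_d.

(* The image of Lebesgue measure on [[0, 1)]. *)
Definition circle_haar (R : realType) : set (borel (circle R)) -> \bar R :=
  pushforward (mrestr (@lebesgue_measure R) (measurable_itv `[0, 1[))
    (@toCircle R : measurableTypeR R -> borel (circle R)).

(* The [d]-fold product of [circle_haar]. *)
Fixpoint torus_haar (R : realType) (d : nat) :
    set (borel (torus R d)) -> \bar R :=
  if d is d'.+1 then
    pushforward (@circle_haar R \x @torus_haar R d')%E
      (fun p : borel (circle R) * borel (torus R d') =>
         row_mx (const_mx p.1 : torus R 1) p.2 : borel (torus R (1 + d')))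
  else @dirac _ (borel (torus R 0)) 0 R.

Definition dotv (R : realType) (d : nat) (u w : 'rV[R]_d) : R :=
  \sum_i u 0 i * w 0 i.

Lemma dotv_continuous (R : realType) (d : nat) (u : 'rV[R]_d) :
  continuous (dotv u).
Proof.
apply: (@continuous_big _ _ _ _ _ _ _ _
  (fun i (w : 'rV[R]_d) => u 0 i * w 0 i)) => [|i _]; first exact: add_continuous.
by move=> w; apply: continuousM; [exact: cst_continuous | exact: coord_continuous].
Qed.

Definition C1_on (R : realType) (n m : nat) (D : set 'rV[R]_n)
    (f : 'rV[R]_n -> 'rV[R]_m) : Prop :=
  forall x, D x -> differentiable f x /\ {for x, continuous (jacobian f)}.

(* A chart is identified with its domain [U]; [chart_inv U] is the inverse of
   the coordinate map [chart U : U -> chart U @` U]. *)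
Record C1_manifold (R : realType) (n : nat) (M : ptopologicalType) :=
  C1Manifold {
    atlas : set (set M);
    chart : set M -> M -> 'rV[R]_n;
    chart_inv : set M -> 'rV[R]_n -> M;
    manifold_hausdorff : hausdorff_space M;
    atlas_cover : \bigcup_(U in atlas) U = setT;
    atlas_open : forall U, atlas U -> open U;
    chart_open : forall U, atlas U -> open (chart U @` U);
    chart_homeo : forall U, atlas U ->
      homeo_between U (chart U @` U) (chart U) (chart_inv U);
    transition_C1 : forall U V, atlas U -> atlas V ->
      C1_on (chart U @` (U `&` V)) (chart V \o chart_inv U)
  }.

(* As above, [triv_inv U] is the inverse of the trivialization
   [triv U : bundle_proj @^-1` U -> U `*` setT]. *)
Record tori_bundle (R : realType) (n d : nat) (M Omega : ptopologicalType)
    (X : C1_manifold R n M) := ToriBundle {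
  bundle_proj : Omega -> M;
  triv : set M -> Omega -> M * torus R d;
  triv_inv : set M -> M * torus R d -> Omega;
  bundle_proj_continuous : continuous bundle_proj;
  triv_homeo : forall U, atlas X U ->
    homeo_between (bundle_proj @^-1` U) (U `*` setT) (triv U) (triv_inv U);
  triv_proj : forall U, atlas X U ->
    {in bundle_proj @^-1` U, fst \o triv U =1 bundle_proj}
}.

Section bundle.
Context (R : realType) (n d : nat) (M Omega : ptopologicalType).
Context (X : C1_manifold R n M) (B : tori_bundle d Omega X).
Implicit Types (mu : probability (borel Omega) R) (U : set M).

Lemma atlas_measurable U : atlas X U -> measurable (U : set (borel M)).
Proof. by move=> hU; apply: open_borel; exact: atlas_open hU. Qed.

(* The projection as a map of Borel spaces. *)
Definition mproj : borel Omega -> borel M := bundle_proj B.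

Lemma mproj_measurable : measurable_fun setT mproj.
Proof. by apply: continuous_borel; exact: bundle_proj_continuous. Qed.

Lemma preimage_atlas_measurable U : atlas X U ->
  measurable (bundle_proj B @^-1` U : set (borel Omega)).
Proof.
move=> /atlas_measurable mU.
by rewrite -[X in measurable X]setTI; exact: mproj_measurable.
Qed.

HB.instance Definition _ := @isMeasurableFun.Build _ _ (borel Omega) (borel M)
  mproj mproj_measurable.

Definition base_measure mu : probability (borel M) R :=
  distribution mu mproj.

Definition compatible_measure mu : Prop :=
  forall U (hU : atlas X U) (A : set (borel M * borel (torus R d))),
    measurable A ->
    pushforward (mrestr mu (preimage_atlas_measurable hU))
      (triv B U : borel Omega -> borel M * borel (torus R d)) A =
    (mrestr (base_measure mu) (atlas_measurable hU) \x @torus_haar R d)%E A.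

(* As [triv U] is a total function, [flow_stable] is needed to express that
   [triv U \o g t \o triv_inv U] is defined on all of [U `*` setT]. *)
Record compatible_flow (g : R -> Omega -> Omega) := CompatibleFlow {
  velocity : set M -> M -> 'rV[R]_d;
  velocity_measurable : forall U, atlas X U ->
    measurable_fun (U : set (borel M))
      (velocity U : borel M -> borel 'rV[R]_d);
  flow_stable : forall U, atlas X U -> forall t,
    set_fun (bundle_proj B @^-1` U) (bundle_proj B @^-1` U) (g t);
  flowE : forall U, atlas X U -> forall t x y, U x ->
    triv B U (g t (triv_inv B U (x, y))) =
    (x, y + map_mx (@toCircle R) (t *: velocity U x))
}.

Section frequencies.
Context (g : R -> Omega -> Omega) (F : compatible_flow g).
Context (mu : probability (borel Omega) R).
Context (U : set M) (hU : atlas X U) (xi : 'rV[int]_d).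

Definition frequency (x : borel M) : measurableTypeR R :=
  dotv (map_mx intr xi) (velocity F U x).

Lemma frequency_measurable : measurable_fun (U : set (borel M)) frequency.
Proof.
apply: (@measurableT_comp _ _ _ _ (borel 'rV[R]_d) (measurableTypeR R)).
  by apply: continuous_borelR; exact: dotv_continuous.
exact: velocity_measurable.
Qed.

(* The measure [m_(xi, U)]: the push-forward of the restriction to [U] of the
   base measure by [x |-> <xi | velocity U x>]. *)
Definition frequency_measure : set (measurableTypeR R) -> \bar R :=
  pushforward (mrestr (base_measure mu) (atlas_measurable hU)) frequency.

Let frequency_preimage (A : set (measurableTypeR R)) :
  measurable A -> measurable (frequency @^-1` A `&` U).
Proof.
move=> mA; rewrite setIC.
exact: frequency_measurable (atlas_measurable hU) _ mA.
Qed.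

Let frequency_measure0 : frequency_measure set0 = 0%E.
Proof. by rewrite /frequency_measure /pushforward preimage_set0 measure0. Qed.

Let frequency_measure_ge0 A : (0 <= frequency_measure A)%E.
Proof. by rewrite /frequency_measure /pushforward /mrestr measure_ge0. Qed.

Let frequency_measure_additive : semi_sigma_additive frequency_measure.
Proof.
move=> S mS tS mUS; rewrite /frequency_measure /pushforward /mrestr.
rewrite preimage_bigcup setI_bigcupl.
apply: measure_semi_sigma_additive.
- by move=> k; exact: frequency_preimage.
- apply/trivIsetP => i j _ _ ij; move/trivIsetP : tS => /(_ _ _ _ _ ij) tS.
  by rewrite setIACA -preimage_setI tS// preimage_set0 set0I.
- by rewrite -setI_bigcupl -preimage_bigcup; exact: frequency_preimage.
Qed.

HB.instance Definition _ := isMeasure.Build _ _ _ frequency_measure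
  frequency_measure0 frequency_measure_ge0 frequency_measure_additive.

Let frequency_measure_fin : fin_num_fun frequency_measure.
Proof.
move=> A mA; rewrite /frequency_measure /pushforward /mrestr.
by apply: fin_num_measure; exact: frequency_preimage.
Qed.

HB.instance Definition _ := Measure_isFinite.Build _ _ _ frequency_measure
  frequency_measure_fin.

End frequencies.

End bundle.

Definition complex_integral d (T : measurableType d) (R : realType)
    (nu : {measure set T -> \bar R}) (f : T -> R[i]) : R[i] :=
  (\int[nu]_x complex.Re (f x) +i* \int[nu]_x complex.Im (f x))%C.

Definition fourier (R : realType)
    (nu : {finite_measure set (measurableTypeR R) -> \bar R}) (t : R) : R[i] :=
  complex_integral nu
    (fun x : R => (cos (2 * pi * t * x) +i* sin (2 * pi * t * x))%C).

Definition rajchman (R : realType)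
    (nu : {finite_measure set (measurableTypeR R) -> \bar R}) : Prop :=
  ComplexField.Normc.normc (fourier nu t) @[t --> +oo] --> (0 : R) /\
  ComplexField.Normc.normc (fourier nu t) @[t --> -oo] --> (0 : R).

Section restriction.
Context d (T : measurableType d) (R : realType).
Context (nu : {finite_measure set T -> \bar R}) (D : set T) (mD : measurable D).

Fact finite_measure_lty : (nu D < +oo)%E.
Proof. by rewrite -ge0_fin_numE// fin_num_measure. Qed.

Definition restriction : {finite_measure set T -> \bar R} :=
  mfrestr mD finite_measure_lty.

End restriction.

Fact measurable_nonzero (R : realType) :
  measurable ([set~ 0] : set (measurableTypeR R)).
Proof. exact: measurableC. Qed.
Arguments measurable_nonzero R : clear implicits.

Record measure_preserving_flow d (T : measurableType d) (R : realType)
    (mu : {measure set T -> \bar R}) (g : R -> T -> T) : Prop := {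
  flow0 : g 0 = id;
  flowD : forall s t, g (s + t) = g s \o g t;
  flow_measurable : forall t, measurable_fun setT (g t);
  flow_preserving : forall t A, measurable A -> pushforward mu (g t) A = mu A
}.

Section shear.
Context d (T : measurableType d) (R : realType) (mu : probability T R).

Definition invariant_sets (g : R -> T -> T) : set (set T) :=
  [set A | measurable A /\ forall t, mu (A `+` g t @^-1` A) = 0%E].

(* [h] is a version of the conditional expectation [E(f | I)], where [I] is a
   sub-sigma-algebra. *)
Definition is_cond_exp (I : set (set T)) (f h : T -> R) : Prop :=
  [/\ forall S : set R, measurable S -> I (h @^-1` S),
      mu.-integrable setT (EFin \o h) &
      forall A, I A -> \int[mu]_(x in A) h x = \int[mu]_(x in A) f x].

(* Weak convergence in [L^2] as [t] tends to [+oo]. *)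
Definition weak_cvg_L2 (f : R -> T -> R) (h : T -> R) : Prop :=
  [/\ forall t, f t \in Lfun mu 2%:E, h \in Lfun mu 2%:E &
      forall k, k \in Lfun mu 2%:E ->
        \int[mu]_x (f t x * k x) @[t --> +oo] --> \int[mu]_x (h x * k x)].

Definition keplerian_shear (g : R -> T -> T) : Prop :=
  forall f, f \in Lfun mu 2%:E ->
  exists2 h, is_cond_exp (invariant_sets g) f h &
             weak_cvg_L2 (fun t => f \o g t) h.

End shear.

(* Main.v *)
Require Import Defs.
From HB Require Import structures.
From mathcomp Require Import all_boot all_order all_algebra.
From mathcomp Require Import complex.
From mathcomp Require Import all_classical all_reals all_analysis.
From mathcomp Require Import measurable_realfun.
From mathcomp Require Import ring lra.

(** The flow is studied through the waves [w |-> h (x) cos (2 pi <xi|y> + a)], where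
    [(x, y)] are the coordinates of [w] over a chart [U].  Their correlations under
    the flow are oscillating integrals [int h (z) cos (2 pi t z + a) dm (z)], where
    [m] is the measure [m_(xi, U)] restricted to the nonzero reals.

    Shear makes all these integrals converge.  Since
    [2 sin (pi s z) cos (2 pi t z + a)] is a difference of two translates in [t] of
    the same oscillation, the integrals with the factor [sin (pi s z)] tend to 0;
    letting [s] tend to 0 removes that factor outside [z = 0], and [h = 1] gives the
    Rajchman property.

    Conversely, if every [m] is Rajchman then [f \o g t] is asymptotically
    orthogonal to [f] for every wave [f] carried by the set of nonzero frequencies,
    and van der Corput's inequality makes it weakly null; waves carried by the zero
    frequencies are invariant.  The waves over [U] generate the Borel sets of the
    part of the bundle above [U], and functions whose orbit converges weakly to an
    invariant function form a closed subspace of [L^2]; countably many charts then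
    give all of [L^2]. *)

Set Implicit Arguments.
Unset Strict Implicit.
Unset Printing Implicit Defensive.

Import Order.TTheory GRing.Theory Num.Theory.
Import numFieldNormedType.Exports.

Local Open Scope classical_set_scope.
Local Open Scope ring_scope.

(** * L2 over a probability space *)

(** Shear only says that correlations converge; to identify the limit one would have to compute the
    conditional expectation of a wave. The difference of two translates in time cancels the limit
    whatever its value, so the direct implication never computes an expectation. In the converse, an
    amplitude [h] on the base is constant along orbits and can be moved from the wave to the test
    function: decay for the amplitude 1, which is the Rajchman property itself, suffices, and no
    stability of that property under densities has to be proved. The space [L^2] is real, so
    exponentials give way to cosines with a free phase. Phases 0 and [- (pi / 2)] recover real and
    imaginary parts, and the phase may vary with the base point because the flow only shifts it.
    Weak limits of orbits are asked to be invariant at every point, not almost everywhere: preimages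
    under them are then invariant sets at once, and they are versions of the conditional
    expectation. This pointwise invariance has to survive [L^2] limits, which dictates how those
    limits are constructed. *)

Section L2.
Context d (T : measurableType d) (R : realType) (mu : probability T R).
Implicit Types f k h : T -> R.

Local Notation L2 := (Lfun mu 2%:E).

Lemma Lfun2P f :
  f \in L2 <->
  measurable_fun setT f /\ mu.-integrable setT (EFin \o (fun x => f x ^+ 2)).
Proof.
split=> [fL|[mf f2]].
  split; last exact: Lfun2_integrable_sqr.
  by move: fL; rewrite inE => /andP[+ _]; rewrite inE.
rewrite inE; apply/andP; split; rewrite inE//= /finite_norm unlock.
apply: poweR_lty.
rewrite (eq_integral (fun x => (f x ^+ 2)%:E)); first exact: integrable_lty.
by move=> x _ /=; rewrite powR_mulrn// -normrX ger0_norm// sqr_ge0.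
Qed.

Lemma Lfun2_measurable f : f \in L2 -> measurable_fun setT f.
Proof. by move=> /Lfun2P[]. Qed.

Lemma Lfun2_bounded f (C : R) : measurable_fun setT f -> (forall x, `|f x| <= C) -> f \in L2.
Proof.
move=> mf fC; apply/Lfun2P; split => //.
apply: measurable_bounded_integrable => //.
- by rewrite -ge0_fin_numE// fin_num_measure.
- exact: measurable_funX.
- exists (C ^+ 2); split; first exact: num_real.
  move=> r Cr x _ /=; rewrite (le_trans _ (ltW Cr))// normrX.
  by rewrite lerXn2r// ?nnegrE// (le_trans (normr_ge0 (f x))).
Qed.

Lemma Lfun2D f k : f \in L2 -> k \in L2 -> (fun x => f x + k x) \in L2.
Proof. by move=> fL kL; apply: (rpredD (_ : f \in L2)); rewrite ?lee1n. Qed.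

Lemma Lfun2Z c f : f \in L2 -> (fun x => c * f x) \in L2.
Proof.
move=> /(Lfun_scale c (ler1n R 2)) h.
by rewrite (_ : (fun _ => _) = c \o* f)//; apply/funext => x /=; rewrite mulrC.
Qed.

Lemma Lfun2B f k : f \in L2 -> k \in L2 -> (fun x => f x - k x) \in L2.
Proof.
move=> fL /(Lfun2Z (-1)) kL; have := Lfun2D fL kL.
by under [X in X \in _ -> _]eq_fun do rewrite mulN1r.
Qed.

Definition inner f k : R := \int[mu]_x (f x * k x).

Lemma ip_integrable f k : f \in L2 -> k \in L2 ->
  mu.-integrable setT (EFin \o (fun x => f x * k x)).
Proof. by move=> fL kL; apply/Lfun1_integrable; exact: Lfun2_mul_Lfun1. Qed.

Lemma ipC f k : inner f k = inner k f.
Proof. by apply: eq_Rintegral => x _; rewrite mulrC. Qed.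

Lemma ipDl f1 f2 k : f1 \in L2 -> f2 \in L2 -> k \in L2 ->
  inner (fun x => f1 x + f2 x) k = inner f1 k + inner f2 k.
Proof.
move=> f1L f2L kL; rewrite /inner -RintegralD//; try exact: ip_integrable.
by apply: eq_Rintegral => x _; rewrite mulrDl.
Qed.

Lemma ipZl c f k : f \in L2 -> k \in L2 -> inner (fun x => c * f x) k = c * inner f k.
Proof.
move=> fL kL; rewrite /inner -RintegralZl//; try exact: ip_integrable.
by apply: eq_Rintegral => x _; rewrite mulrA.
Qed.

Lemma ipBl f1 f2 k : f1 \in L2 -> f2 \in L2 -> k \in L2 ->
  inner (fun x => f1 x - f2 x) k = inner f1 k - inner f2 k.
Proof.
move=> f1L f2L kL; rewrite /inner -RintegralB//; try exact: ip_integrable.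
by apply: eq_Rintegral => x _; rewrite mulrBl.
Qed.

Lemma ip_ge0 f : 0 <= inner f f.
Proof. by apply: Rintegral_ge0 => x _; rewrite -expr2 sqr_ge0. Qed.

Definition norm2 f : R := Num.sqrt (inner f f).

Lemma sqr_norm2 f : norm2 f ^+ 2 = inner f f.
Proof. by rewrite sqr_sqrtr// ip_ge0. Qed.

Lemma norm2_ge0 f : 0 <= norm2 f.
Proof. exact: sqrtr_ge0. Qed.

Lemma ipDD a b f k : f \in L2 -> k \in L2 ->
  inner (fun x => a * f x + b * k x) (fun x => a * f x + b * k x) =
  a ^+ 2 * inner f f + 2 * a * b * inner f k + b ^+ 2 * inner k k.
Proof.
move=> fL kL; have [afL bkL] := (Lfun2Z a fL, Lfun2Z b kL).
rewrite ipDl//; last exact: Lfun2D.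
rewrite ![inner _ (fun x => _ + _)]ipC !ipDl// !ipZl//.
rewrite ![inner _ (fun x => _ * _)]ipC !ipZl// (ipC k f); ring.
Qed.

(** Cauchy-Schwarz from the positivity of the form in [ipDD]: the coefficients [inner k k] and
    [- inner f k] produce the discriminant, once the case [inner k k = 0] is set apart. *)
Lemma ip_le_norm2 f k : f \in L2 -> k \in L2 -> `|inner f k| <= norm2 f * norm2 k.
Proof.
move=> fL kL.
have [/eqP k0|k0] := boolP (inner k k == 0).
  suff -> : inner f k = 0 by rewrite normr0 mulr_ge0 ?norm2_ge0.
  apply/eqP; apply: contraT => fk0.
  (* If [inner f k] were nonzero, this coefficient would give the form the value -1. *)
  have := ip_ge0 (fun x => 1 * f x + (- (inner f f + 1) / (2 * inner f k)) * k x).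
  rewrite ipDD// k0 mulr0 addr0 expr1n mul1r.
  rewrite (_ : _ * _ * _ * inner f k = - (inner f f + 1)); last by field.
  by rewrite opprD addrA subrr sub0r oppr_ge0 real_leNgt ?ltr01.
have := ip_ge0 (fun x => inner k k * f x + (- inner f k) * k x).
have kk : 0 < inner k k by rewrite lt_def k0 ip_ge0.
rewrite ipDD// (_ : _ + _ = inner k k * (inner f f * inner k k - inner f k ^+ 2)); last by ring.
rewrite pmulr_rge0// subr_ge0 => H.
by rewrite /norm2 -sqrtrM ?ip_ge0// -sqrtr_sqr ler_sqrt// mulr_ge0// ip_ge0.
Qed.

Lemma norm2D f k : f \in L2 -> k \in L2 ->
  norm2 (fun x => f x + k x) <= norm2 f + norm2 k.
Proof.
move=> fL kL.
rewrite -(@ler_pXn2r _ 2)// ?nnegrE ?addr_ge0 ?norm2_ge0// sqr_norm2.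
have := @ipDD 1 1 f k fL kL; under eq_fun do rewrite !mul1r; move=> ->.
rewrite sqrrD !sqr_norm2 !expr1n !mul1r !mulr1 lerD2r lerD2l mulr2n mulrDl !mul1r.
by have := le_trans (ler_norm _) (ip_le_norm2 fL kL) => h; rewrite lerD.
Qed.

Lemma norm2_subC f k : norm2 (fun x => f x - k x) = norm2 (fun x => k x - f x).
Proof. by congr Num.sqrt; apply: eq_Rintegral => x _; ring. Qed.

Lemma norm2_triangle f1 f2 f3 : f1 \in L2 -> f2 \in L2 -> f3 \in L2 ->
  norm2 (fun x => f1 x - f3 x) <=
  norm2 (fun x => f1 x - f2 x) + norm2 (fun x => f2 x - f3 x).
Proof.
move=> f1L f2L f3L; rewrite -(_ : (fun x => (f1 x - f2 x) + (f2 x - f3 x)) = (fun x => f1 x - f3 x)).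
  by apply: norm2D; exact: Lfun2B.
by apply/funext => x; rewrite addrA subrK.
Qed.

End L2.

(** * Completeness of L2, for sequences with geometric increments *)

Section L2_complete.
Context d (T : measurableType d) (R : realType) (mu : probability T R).
Local Notation L2 := (Lfun mu 2%:E).
Local Notation N2 := (norm2 mu).
Local Notation ip := (inner mu).

(** Bounded variation makes the telescoping series absolutely convergent. *)
Lemma cvgn_telescope_bound (u : R^nat) (C : R) :
  (forall n, \sum_(0 <= k < n) `|u k.+1 - u k| <= C) -> cvgn u.
Proof.
move=> uC; suff /(is_cvgD (is_cvg_cst (u 0%N))) : cvgn (series (telescope u)).
  rewrite (_ : _ + _ = u) //; apply/funext => n.
  by rewrite [RHS](eq_sum_telescope u n).
apply: normed_cvg; apply: nondecreasing_is_cvgn.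
  by apply: nondecreasing_series => n _ _; exact: normr_ge0.
by exists C => _ [n _ <-]; exact: uC.
Qed.

Lemma norm2_cst1 : N2 (fun=> 1) = 1.
Proof.
rewrite /norm2 /inner Rintegral_cst// !mul1r -[RHS]sqrtr1; congr Num.sqrt.
exact: (congr1 fine (probability_setT mu)).
Qed.

Lemma Rintegral_abs_le_norm2 (f : T -> R) : f \in L2 ->
  \int[mu]_x `|f x| <= N2 f.
Proof.
move=> fL; have afL : (fun x => `|f x|) \in L2.
  move/Lfun2P : fL => [mf f2]; apply/Lfun2P; split; first exact: measurableT_comp.
  by under eq_fun do rewrite real_normK ?num_real//.
have := ip_le_norm2 afL (Lfun_cst mu 1 2); rewrite norm2_cst1 mulr1.
rewrite (_ : N2 (fun x => `|f x|) = N2 f); last first.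
  congr Num.sqrt; apply: eq_Rintegral => x _.
  by rewrite -!expr2 real_normK ?num_real.
apply: le_trans; rewrite /inner; under [X in `|X|]eq_Rintegral do rewrite mulr1.
exact: ler_norm.
Qed.

Lemma integral_sqr (f : T -> R) : f \in L2 ->
  (\int[mu]_x (f x ^+ 2)%:E = (N2 f ^+ 2)%:E)%E.
Proof.
move=> fL; rewrite sqr_norm2 /inner /Rintegral fineK//.
by apply: integrable_fin_num => //; exact: ip_integrable.
Qed.

Variable h : nat -> T -> R.
Hypothesis hL : forall n, h n \in L2.
Hypothesis hC : forall n, N2 (fun x => h n.+1 x - h n x) <= 2^-1 ^+ n.

Let dL n : (fun x => h n.+1 x - h n x) \in L2.
Proof. exact: Lfun2B. Qed.

Let a n x := `|h n.+1 x - h n x|.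

Let ma n : measurable_fun setT (a n).
Proof. by apply: measurableT_comp => //; exact: Lfun2_measurable (dL n). Qed.

Let a0 n x : (0 <= (a n x)%:E)%E.
Proof. by rewrite lee_fin normr_ge0. Qed.

(** On a probability space the [L^1] norm is at most the [L^2] norm, so the total variation of
    [h ^~ x] has integral at most 2 and is finite almost everywhere. *)
Let ae_cvg : {ae mu, forall x, cvgn (h ^~ x)}.
Proof.
pose g x : \bar R := (\sum_(n <oo) (a n x)%:E)%E.
have gi : mu.-integrable setT g.
  apply/integrableP; split.
    by apply: (ge0_emeasurable_sum (P := predT)) => [n x _ _|n _]; [exact: a0|exact/measurable_EFinP/ma].
  rewrite (eq_integral g); last first.
    by move=> x _; rewrite gee0_abs// nneseries_ge0// => n _ _; exact: a0.
  rewrite integral_nneseries; last 3 first.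
  - by [].
  - by move=> n; exact/measurable_EFinP/ma.
  - by move=> n x _; exact: a0.
  apply: (@le_lt_trans _ _ 2%:E); last exact: ltry.
  apply: lime_le.
    by apply: is_cvg_nneseries => n _ _; apply: integral_ge0 => x _; exact: a0.
  apply: nearW => n.
  apply: (@le_trans _ _ (\sum_(0 <= i < n) (2^-1 ^+ i)%:E)%E).
    apply: lee_sum => i _; rewrite -[leLHS]fineK; last first.
      apply: integrable_fin_num => //; apply: integrable_norm.
      by apply/Lfun1_integrable; apply: Lfun_subset12 => //; rewrite fin_num_measure.
    by rewrite lee_fin (le_trans _ (hC i))//; exact: Rintegral_abs_le_norm2.
  rewrite sumEFin lee_fin.
  rewrite (_ : \sum_(0 <= i < n) _ = 2 - 2 * 2^-1 ^+ n); last first.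
    elim: n => [|n IH]; first by rewrite big_geq// expr0; ring.
    by rewrite big_nat_recr//= IH exprS; field.
  by rewrite lerBlDr lerDl mulr_ge0// exprn_ge0.
have := integrable_ae measurableT gi; apply: filterS => x /(_ I) gx.
apply: (@cvgn_telescope_bound _ (fine (g x))) => n.
rewrite -lee_fin fineK// -sumEFin.
by apply: nneseries_lim_ge => k _ _; exact: a0.
Qed.

(** The upper limit exists at every point and is compatible with composition on the right: if every
    [h n] is invariant under a map, so is [L2_lim], with no exceptional null set. *)
Definition L2_lim x : R := fine (limn_esup (fun n => (h n x)%:E)).

Lemma measurable_L2_lim : measurable_fun setT L2_lim.
Proof.
apply: measurableT_comp => //; apply: measurable_fun_limn_esup => n.
exact/measurable_EFinP/Lfun2_measurable.
Qed.

Let ae_lim : {ae mu, forall x, h ^~ x @ \oo --> L2_lim x}.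
Proof.
apply: filterS ae_cvg => x /cvg_ex[l hl].
have /cvg_limn_einf_sup[_] : (h n x)%:E @[n --> \oo] --> l%:E by apply: cvg_EFin => //; exact: nearW.
by rewrite /L2_lim => -> /=.
Qed.

Let norm2_gap n m : N2 (fun x => h n x - h (n + m)%N x) <= 2 * 2^-1 ^+ n.
Proof.
suff : N2 (fun x => h n x - h (n + m)%N x) <= 2 * 2^-1 ^+ n - 2 * 2^-1 ^+ (n + m).
  by move/le_trans; apply; rewrite lerBlDr lerDl mulr_ge0// exprn_ge0.
elim: m => [|m IH].
  rewrite addn0 subrr; under eq_fun do rewrite subrr.
  rewrite /norm2 /inner; under eq_Rintegral do rewrite mul0r.
  by rewrite /Rintegral integral0 sqrtr0.
rewrite (le_trans (norm2_triangle (hL n) (hL (n + m)) (hL _)))//.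
rewrite (le_trans (lerD IH (lexx _)))// norm2_subC addnS.
rewrite (le_trans (lerD (lexx _) (hC _)))// exprS; set y := _ ^+ (n + m).
by rewrite le_eqVlt; apply/orP; left; apply/eqP; field.
Qed.

(** Fatou's lemma: almost everywhere the integrand is the limit in [m] of [(h n x - h m x) ^+ 2],
    whose integrals are controlled by [norm2_gap]. *)
Let tail n : (\int[mu]_x ((h n x - L2_lim x) ^+ 2)%:E <=
  ((2 * 2^-1 ^+ n) ^+ 2)%:E)%E.
Proof.
have mh m : measurable_fun setT (fun x => ((h n x - h m x) ^+ 2)%:E).
  apply/measurable_EFinP/measurable_funX/Lfun2_measurable.
  exact: (Lfun2B (hL n) (hL m)).
have mh' : measurable_fun setT (fun x => ((h n x - L2_lim x) ^+ 2)%:E).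
  apply/measurable_EFinP/measurable_funX/measurable_funB.
    exact: Lfun2_measurable (hL n).
  exact: measurable_L2_lim.
apply: (@le_trans _ _ (\int[mu]_x limn_einf (fun m => ((h n x - h m x) ^+ 2)%:E))%E).
  apply: ae_ge0_le_integral => //.
  - by move=> x _; rewrite lee_fin sqr_ge0.
  - move=> x _; rewrite limn_einf_lim; apply: lime_ge; first exact: is_cvg_einfs.
    apply: nearW => k; apply: le_ereal_inf_tmp => _ [p _ <-].
    by rewrite lee_fin sqr_ge0.
  - by apply: measurableT_comp => //; apply: measurable_fun_limn_esup => m; apply: measurableT_comp.
  - apply: filterS ae_lim => x hx _.
    have [-> _] // : (limn_einf (fun m => ((h n x - h m x) ^+ 2)%:E) =
      ((h n x - L2_lim x) ^+ 2)%:E) * (limn_esup (fun m => ((h n x - h m x) ^+ 2)%:E) =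
      ((h n x - L2_lim x) ^+ 2)%:E).
    apply: cvg_limn_einf_sup; apply: cvg_EFin; first exact: nearW.
    by apply: cvgM; apply: cvgB => //; exact: cvg_cst.
apply: le_trans (fatou mu measurableT mh _) _.
  by move=> m x _; rewrite lee_fin sqr_ge0.
rewrite limn_einf_lim; apply: lime_le; first exact: is_cvg_einfs.
apply: nearW => k.
(* The infimum over the indices from [k] on is at most its term at [n + k], to which [norm2_gap]
   applies. *)
apply: (@le_trans _ _ (\int[mu]_x ((h n x - h (n + k)%N x) ^+ 2)%:E)%E).
  by apply: ereal_inf_lbound => /=; exists (n + k)%N => //=; exact: leq_addl.
rewrite (integral_sqr (Lfun2B (hL _) (hL _))) lee_fin.
by rewrite lerXn2r ?norm2_gap ?nnegrE ?norm2_ge0 ?mulr_ge0 ?exprn_ge0.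
Qed.

Let tailL n : (fun x => h n x - L2_lim x) \in L2.
Proof.
have m1 : measurable_fun setT (fun x => h n x - L2_lim x).
  by apply: measurable_funB; [exact: Lfun2_measurable|exact: measurable_L2_lim].
apply/Lfun2P; split => //; apply/integrableP; split.
  exact/measurable_EFinP/measurable_funX.
under eq_integral do rewrite gee0_abs ?lee_fin ?sqr_ge0//.
exact: le_lt_trans (tail n) (ltry _).
Qed.

Lemma L2_lim_Lfun : L2_lim \in L2.
Proof.
have := Lfun2B (hL 0%N) (tailL 0%N).
by under eq_fun do rewrite opprB addrC subrK.
Qed.

Lemma norm2_L2_lim n : N2 (fun x => h n x - L2_lim x) <= 2 * 2^-1 ^+ n.
Proof.
rewrite -(@ler_pXn2r _ 2)// ?nnegrE ?norm2_ge0 ?mulr_ge0 ?exprn_ge0//.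
by rewrite -lee_fin -integral_sqr// tail.
Qed.

End L2_complete.

(** * Change of variables along a measurable map *)

Section image_measure.
Context d1 d2 (X : measurableType d1) (Y : measurableType d2) (R : realType).
Context (mu : {measure set X -> \bar R}) (nu : {measure set Y -> \bar R}).
Context (phi : X -> Y) (mphi : measurable_fun setT phi).
Hypothesis nuE : forall A, measurable A -> nu A = mu (phi @^-1` A).

Lemma ge0_integral_image (f : Y -> \bar R) : measurable_fun setT f ->
  (forall y, 0 <= f y)%E -> (\int[nu]_y f y = \int[mu]_x f (phi x))%E.
Proof.
move=> mf f0; rewrite -(preimage_setT phi) -ge0_integral_pushforward//.
by apply: eq_measure_integral => A mA _; rewrite nuE.
Qed.

Lemma integrable_image (f : Y -> R) : measurable_fun setT f ->
  nu.-integrable setT (EFin \o f) <-> mu.-integrable setT (EFin \o (f \o phi)).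
Proof.
move=> mf; have mf' := measurableT_comp mf mphi.
have E : (\int[nu]_y `|(f y)%:E| = \int[mu]_x `|(f (phi x))%:E|)%E.
  by apply: ge0_integral_image => //; exact/measurableT_comp/measurable_EFinP.
split=> /integrableP[_ fi]; apply/integrableP; split; try exact/measurable_EFinP.
  by rewrite -E.
by rewrite E.
Qed.

Lemma Rintegral_image (f : Y -> R) : measurable_fun setT f ->
  nu.-integrable setT (EFin \o f) -> \int[nu]_y f y = \int[mu]_x f (phi x).
Proof.
move=> mf fi; congr fine; rewrite -(preimage_setT phi).
rewrite -[RHS](integral_pushforward mphi (f := EFin \o f))//.
- by apply: eq_measure_integral => A mA _; rewrite nuE.
- exact/measurable_EFinP.
- by rewrite preimage_setT; apply/integrable_image.
Qed.

End image_measure.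

(** * The isometric action of the flow on L2 and weak limits of orbits *)

Section flow.
Context d (T : measurableType d) (R : realType) (mu : probability T R).
Context (g : R -> T -> T) (mpf : measure_preserving_flow mu g).
Implicit Types f k h : T -> R.
Local Notation L2 := (Lfun mu 2%:E).
Local Notation N2 := (norm2 mu).
Local Notation ip := (inner mu).

Let mg t : measurable_fun setT (g t).
Proof. exact: flow_measurable mpf t. Qed.

Let gE t A : measurable A -> mu A = mu (g t @^-1` A).
Proof. by move=> mA; rewrite -[LHS](flow_preserving mpf t mA). Qed.

Lemma Lfun2_flow f t : f \in L2 -> f \o g t \in L2.
Proof.
move=> /Lfun2P[mf f2]; apply/Lfun2P; split; first exact: measurableT_comp.
have m2 : measurable_fun setT (fun x => f x ^+ 2) by exact: measurable_funX.
exact/(integrable_image (mg t) (@gE t) m2).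
Qed.

Lemma ip_flow f k t : f \in L2 -> k \in L2 -> ip (f \o g t) (k \o g t) = ip f k.
Proof.
move=> fL kL; rewrite /inner [RHS](Rintegral_image (mg t) (@gE t))//.
  exact: measurable_funM (Lfun2_measurable fL) (Lfun2_measurable kL).
exact: ip_integrable.
Qed.

Lemma norm2_flow f t : f \in L2 -> N2 (f \o g t) = N2 f.
Proof. by move=> fL; rewrite /norm2 ip_flow. Qed.

Lemma flow_comp f s t : (f \o g s) \o g t = f \o g (s + t).
Proof. by rewrite (flowD mpf). Qed.

Lemma ip_flow_shift f k s t : f \in L2 -> k \in L2 ->
  ip (f \o g t) (k \o g s) = ip (f \o g (t - s)) k.
Proof.
move=> fL kL; rewrite -(@ip_flow _ k s)//; last exact: Lfun2_flow.
by rewrite flow_comp subrK.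
Qed.

(** Invariance of [h] is an equality of functions, so that preimages under [h] are exactly invariant
    sets. *)
Definition invariant_limit f h :=
  [/\ f \in L2, h \in L2, forall t, h \o g t = h &
    forall k, k \in L2 -> ip (f \o g t) k @[t --> +oo] --> ip h k].

Lemma invariant_limitD f1 f2 h1 h2 : invariant_limit f1 h1 -> invariant_limit f2 h2 ->
  invariant_limit (fun x => f1 x + f2 x) (fun x => h1 x + h2 x).
Proof.
move=> [f1L h1L h1i c1] [f2L h2L h2i c2]; split; try exact: Lfun2D.
  by move=> t; apply/funext => x /=; rewrite -[in RHS](h1i t) -[in RHS](h2i t).
move=> k kL; rewrite ipDl//.
under eq_cvg do rewrite (ipDl (Lfun2_flow _ f1L) (Lfun2_flow _ f2L) kL).
by apply: cvgD; [exact: c1|exact: c2].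
Qed.

Lemma invariant_limitZ c f h : invariant_limit f h ->
  invariant_limit (fun x => c * f x) (fun x => c * h x).
Proof.
move=> [fL hL hi ch]; split; try exact: Lfun2Z.
  by move=> t; apply/funext => x /=; rewrite -[in RHS](hi t).
move=> k kL; rewrite ipZl//.
under eq_cvg do rewrite (ipZl _ (Lfun2_flow _ fL) kL).
by apply: cvgMr; exact: ch.
Qed.

(** Convergence is tested against [h] itself: [inner h h] is a limit of products bounded by
    [N2 f * N2 h]. With linearity, a Cauchy sequence of functions has a Cauchy sequence of weak
    limits. *)
Lemma invariant_limit_norm2 f h : invariant_limit f h -> N2 h <= N2 f.
Proof.
move=> [fL hL hi ch]; have [h0|h0] := leP (N2 h) 0.
  exact: le_trans h0 (norm2_ge0 _ _).
rewrite -(ler_pM2r h0) -expr2 sqr_norm2.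
have cc := ch _ hL; rewrite -(cvg_lim _ cc)//; apply: limr_le; first by apply: cvgP cc.
apply: nearW => t; apply: le_trans (ler_norm _) _.
by rewrite -(norm2_flow t fL); apply: ip_le_norm2 => //; exact: Lfun2_flow.
Qed.

Lemma fast_subsequence (u : R^nat) : u @ \oo --> 0 -> (forall n, 0 <= u n) ->
  exists r : nat -> nat, forall n, u (r n) <= 2^-1 ^+ n.
Proof.
move=> u0 uge0.
have H n : exists m, u m <= 2^-1 ^+ n.
  have e0 : 0 < (2^-1 : R) ^+ n by rewrite exprn_gt0.
  have /cvgr0Pnorm_le /(_ _ e0)[N _ /(_ N (leqnn _))] := u0.
  by rewrite /= ger0_norm// => ?; exists N.
by have [r rE] := choice H; exists r.
Qed.

Lemma invariant_limit_closed (f_ : nat -> T -> R) f :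
  (forall n, exists h, invariant_limit (f_ n) h) -> f \in L2 ->
  N2 (fun x => f_ n x - f x) @[n --> \oo] --> 0 ->
  exists h, invariant_limit f h.
Proof.
move=> /choice[h_ hP] fL fc.
have [r rP] := fast_subsequence fc (fun n => norm2_ge0 _ _).
have fnL n : f_ n \in L2 by case: (hP n).
have hnL n : h_ n \in L2 by case: (hP n).
(* The shift by one matters: consecutive terms are then at distance at most [2^-(n+2) + 2^-(n+1)],
   which is below [2^-n]; without it the bound would be [3/2] times [2^-n]. *)
pose f' n := f_ (r n.+1); pose h' n := h_ (r n.+1).
have h'L n : h' n \in L2 by exact: hnL.
have h'C n : N2 (fun x => h' n.+1 x - h' n x) <= 2^-1 ^+ n.
  have /invariant_limit_norm2 := invariant_limitD (hP (r n.+2)) (invariant_limitZ (-1) (hP (r n.+1))).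
  under eq_fun do rewrite mulN1r; under [X in _ <= N2 X]eq_fun do rewrite mulN1r.
  move/le_trans; apply; rewrite (le_trans (norm2_triangle (fnL _) fL (fnL _)))//.
  rewrite [X in _ + X]norm2_subC (le_trans (lerD (rP _) (rP _)))//.
  rewrite !exprS; set y := _ ^+ n; have : 0 <= y by exact: exprn_ge0.
  lra.
pose h := L2_lim h'.
have hL : h \in L2 by exact: (L2_lim_Lfun h'L h'C).
exists h; split => //.
  move=> t; apply/funext => x; rewrite /h /L2_lim /=; congr (fine (limn_esup _)).
  apply/funext => n; congr EFin; case: (hP (r n.+1)) => _ _ /(_ t) + _.
  by rewrite /h' => {2}<-.
move=> k kL; apply/cvgrPdist_le => e e0.
have K0 : 0 < N2 k + 1 by rewrite ltr_wpDl ?norm2_ge0.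
(* Replacing [h] costs [2 y N2 k] and replacing [f] costs [y N2 k], hence the 3; the [+ 1] covers
   [N2 k = 0]. *)
have /cvgr0Pnorm_le/(_ (e / 2 / 3 / (N2 k + 1))) : (2^-1 : R) ^+ n @[n --> \oo] --> 0.
  by apply: cvg_expr; rewrite ger0_norm// invf_lt1// ltr1n.
case=> [|N _ /(_ N (leqnn N))/=]; first by rewrite !divr_gt0.
set y := _ ^+ N; have y0 : 0 <= y by exact: exprn_ge0.
rewrite ger0_norm// ler_pdivlMr// => yK.
have K1 : y * N2 k <= y * (N2 k + 1) by rewrite ler_wpM2l// lerDl.
case: (hP (r N.+1)) => _ _ _ /(_ k kL)/cvgrPdist_le/(_ (e / 2)).
rewrite divr_gt0// => /(_ isT); apply: filterS => t.
have gL a : a \in L2 -> a \o g t \in L2 by exact: Lfun2_flow.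
have E1 : `|ip h k - ip (h' N) k| <= 2 * y * N2 k.
  rewrite -ipBl// (le_trans (ip_le_norm2 (Lfun2B _ _) _))//.
  by rewrite ler_wpM2r ?norm2_ge0// norm2_subC; exact: norm2_L2_lim.
have E2 : `|ip (f' N \o g t) k - ip (f \o g t) k| <= y * N2 k.
  rewrite -(ipBl (gL _ _) (gL _ _) kL) ?fnL//.
  rewrite (le_trans (ip_le_norm2 (Lfun2B (gL _ _) (gL _ _)) kL)) ?fnL//.
  rewrite ler_wpM2r ?norm2_ge0// (norm2_flow t (Lfun2B (fnL (r N.+1)) fL)).
  by rewrite (le_trans (rP _))// exprS ler_piMl// invf_le1// ler1n.
rewrite -/(h' N) -/(f' N).
move: E1 E2; rewrite !ler_norml => /andP[? ?] /andP[? ?] /andP[? ?].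
by apply/andP; split; lra.
Qed.

End flow.

(** * Dominated convergence in L2 and van der Corput's inequality *)

Section L2_tools.
Context d (T : measurableType d) (R : realType) (mu : probability T R).
Implicit Types f k h : T -> R.
Local Notation L2 := (Lfun mu 2%:E).
Local Notation N2 := (norm2 mu).
Local Notation ip := (inner mu).

(** Dominated convergence for the squared differences, with bound [(2 * G x) ^+ 2], since the limit
    inherits the bound [G]. *)
Lemma norm2_dominated_cvg (f_ : nat -> T -> R) f G : G \in L2 ->
  (forall n, measurable_fun setT (f_ n)) ->
  (forall x, f_ ^~ x @ \oo --> f x) -> (forall n x, `|f_ n x| <= G x) ->
  f \in L2 /\ N2 (fun x => f_ n x - f x) @[n --> \oo] --> 0.
Proof.
move=> GL mf_ f_f f_G.
have mf : measurable_fun setT f by apply: (measurable_fun_cvg mf_) => x _; exact: f_f.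
have fG x : `|f x| <= G x.
  have /cvg_norm cx := f_f x; rewrite -(cvg_lim _ cx)//.
  by apply: limr_le; [exact: cvgP cx|exact: nearW].
have dom (u : T -> R) : measurable_fun setT u -> (forall x, `|u x| <= G x) -> u \in L2.
  move=> mu' uG; apply/Lfun2P; split => //.
  case/Lfun2P : GL => _; apply: le_integrable => //.
    exact/measurable_EFinP/measurable_funX.
  move=> x _ /=; rewrite lee_fin !normrX lerXn2r// ?nnegrE//.
  exact: le_trans (uG x) (ler_norm _).
split; first exact: dom.
have dL n : (fun x => f_ n x - f x) \in L2 by apply: Lfun2B; exact: dom.
have : (\int[mu]_x ((f_ n x - f x) ^+ 2)%:E)%E @[n --> \oo] --> (\int[mu]_x 0)%E.
  apply: (@dominated_cvg _ _ _ mu setT measurableT _ _ (fun x => ((2 * G x) ^+ 2)%:E)) => //.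
  - by move=> n; apply/measurable_EFinP/measurable_funX; exact: Lfun2_measurable (dL n).
  - move=> x _; apply: cvg_EFin; first exact: nearW.
    have : f_ n x - f x @[n --> \oo] --> f x - f x by apply: cvgB (f_f x) (cvg_cst _).
    rewrite subrr => c; rewrite -[in X in _ --> X](mulr0 0).
    rewrite (_ : _ \o _ = (fun n => (f_ n x - f x) * (f_ n x - f x))); first exact: cvgM.
    by apply/funext => n; rewrite /= expr2.
  - by case/Lfun2P : (Lfun2Z 2 GL).
  - move=> n x _; rewrite gee0_abs ?lee_fin ?sqr_ge0//.
    rewrite -real_normK ?num_real// lerXn2r// ?nnegrE//.
      by rewrite mulr_ge0// (le_trans _ (fG x)).
    by rewrite (le_trans (ler_normB _ _))// mulr_natl mulr2n lerD.
rewrite integral0 => c; apply/cvgr0Pnorm_le => e e0.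
have e2 : 0 < e ^+ 2 by rewrite exprn_gt0.
move/fine_cvgP : c => [_ /cvgr0Pnorm_le/(_ _ e2)]; apply: filterS => n.
rewrite /= (integral_sqr (dL n)) /= ger0_norm ?sqr_ge0// ger0_norm ?norm2_ge0//.
by rewrite ler_pXn2r// nnegrE ?norm2_ge0// ltW.
Qed.

(* van der Corput: a sum of [N] signed well-separated members of the family has
   norm of order [sqrt N], whereas its inner product with [k] is of order [N]
   when [ip (u t) k] does not vanish at infinity. *)
Lemma weak_null_of_almost_orthogonal (u : R -> T -> R) (A : R) :
  (forall t, u t \in L2) -> (forall t, ip (u t) (u t) <= A) ->
  (forall s, ip (u t) (u s) @[t --> +oo] --> 0) ->
  forall k, k \in L2 -> ip (u t) k @[t --> +oo] --> 0.
Proof.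
move=> uL uA u0 k kL; apply/cvgr0Pnorm_le => e e0; apply: contrapT => nu.
have far (P : set R) : (\forall t \near +oo, P t) -> exists2 t, P t & e < `|ip (u t) k|.
  move=> hP; apply: contrapT => nP; apply: nu; apply: filterS hP => t Pt.
  by rewrite leNgt; apply/negP => et; apply: nP; exists t.
(* The last conjunct feeds the induction: it provides arbitrarily late times at which the new
   function is nearly orthogonal to [S] while still correlated with [k]. *)
have step N : exists S, [/\ S \in L2, ip S k >= N%:R * e, ip S S <= N%:R * (A + 1) &
    ip (u t) S @[t --> +oo] --> 0].
  elim: N => [|N [S [SL Sk SS uS]]].
    exists (fun=> 0); have z : forall f, ip f (fun=> 0) = 0.
      by move=> f; rewrite /inner; under eq_Rintegral do rewrite mulr0;
        rewrite /Rintegral integral0.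
    rewrite !mul0r; split; rewrite ?z//; first exact: Lfun_cst.
      by rewrite ipC z.
    by under eq_cvg do rewrite z; exact: cvg_cst.
  have /cvgr0Pnorm_le/(_ (1 / 2)) := uS; rewrite divr_gt0// => /(_ isT)/far[t tS tk].
  pose s := Num.sg (ip (u t) k).
  have k0 : ip (u t) k != 0 by rewrite -normr_gt0 (lt_trans e0).
  have s1 : s ^+ 2 = 1 by rewrite sqr_sg k0.
  exists (fun x => 1 * S x + s * u t x).
  have suL : (fun x => s * u t x) \in L2 by exact: Lfun2Z.
  split.
  - by apply: Lfun2D => //; exact: Lfun2Z.
  - rewrite ipDl ?Lfun2Z// ipZl// mul1r ipZl// -normrEsg.
    by rewrite -natr1 mulrDl mul1r lerD// ltW.
  (* The cross term counts twice and is at most [1 / 2], whence the increment [A + 1]. *)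
  - rewrite ipDD// expr1n s1 -natr1.
    have : `|s * ip S (u t)| <= 1 / 2.
      by rewrite normrM normr_sg k0 /= !mul1r (ipC _ S) -div1r.
    rewrite ler_norml => /andP[_ ?]; have := uA t => ?; lra.
  - have : ip (u t') S + s * ip (u t') (u t) @[t' --> +oo] --> 0 + s * 0.
      by apply: cvgD => //; apply: cvgMr; exact: u0.
    rewrite mulr0 addr0; apply: cvg_trans; apply: near_eq_cvg; apply: nearW => t'.
    by rewrite ![ip (u t') _]ipC ipDl ?Lfun2Z// !ipZl// mul1r ![ip _ (u t')]ipC.
have A0 : 0 <= A by rewrite (le_trans (ip_ge0 mu (u 0))).
have Q0 : 0 <= (A + 1) * N2 k ^+ 2 / e ^+ 2.
  by apply: divr_ge0; [apply: mulr_ge0; [exact: addr_ge0|exact: sqr_ge0]|exact: sqr_ge0].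
have [N NK] : exists N : nat, (A + 1) * N2 k ^+ 2 / e ^+ 2 < N%:R.
  exists (Num.bound ((A + 1) * N2 k ^+ 2 / e ^+ 2)); exact: archi_boundP Q0.
have N0 : 0 < N%:R :> R by exact: le_lt_trans NK.
have [S [SL Sk SS _]] := step N.
(* Cauchy-Schwarz gives a bound linear in [N] for a quantity quadratic in [N]; the chosen [N]
   violates it. *)
have : (N%:R * e) ^+ 2 <= N%:R * (A + 1) * N2 k ^+ 2.
  apply: (@le_trans _ _ ((N2 S * N2 k) ^+ 2)).
    rewrite lerXn2r ?nnegrE ?mulr_ge0 ?norm2_ge0 ?(ltW e0)//.
    exact: le_trans Sk (le_trans (ler_norm _) (ip_le_norm2 SL kL)).
  by rewrite exprMn ler_wpM2r ?sqr_ge0// sqr_norm2.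
apply/negP; rewrite -ltNge exprMn expr2 -!mulrA ltr_pM2l//.
by rewrite -ltr_pdivrMr ?exprn_gt0.
Qed.

End L2_tools.

(** * From weak limits of orbits to conditional expectations *)

Section shear_criterion.
Context d (T : measurableType d) (R : realType) (mu : probability T R).
Context (g : R -> T -> T) (mpf : measure_preserving_flow mu g).
Implicit Types f k h : T -> R.
Local Notation L2 := (Lfun mu 2%:E).
Local Notation ip := (inner mu).

(** The flow is isometric, so the inner product of two points of an orbit depends only on the time
    lag; decay of the self-correlation is therefore almost orthogonality. *)
Lemma weak_null_flow f : f \in L2 -> ip (f \o g t) f @[t --> +oo] --> 0 ->
  forall k, k \in L2 -> ip (f \o g t) k @[t --> +oo] --> 0.
Proof.
move=> fL f0; apply: (@weak_null_of_almost_orthogonal _ _ _ _ _ (ip f f)).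
- by move=> t; exact: (Lfun2_flow mpf).
- by move=> t; rewrite (ip_flow mpf).
- move=> s; rewrite (_ : (fun t => ip _ _) = (fun t => ip (f \o g (t - s)) f)).
    by rewrite (cvg_centerr s (fun t => ip (f \o g t) f)).
  by apply/funext => t; exact: (ip_flow_shift mpf).
Qed.

Lemma ip_indic f A : measurable A -> \int[mu]_(x in A) f x = ip f \1_A.
Proof.
move=> mA; rewrite Rintegral_mkcond; apply: eq_Rintegral => x _.
by rewrite patchE indicE; case: (x \in A); rewrite ?mulr1 ?mulr0.
Qed.

(** For an invariant set [A], the indicators [\1_A] and [\1_A \o g t] agree almost everywhere, so
    [inner mu (f \o g t) \1_A] does not depend on [t]. Its limit is the defining identity of the
    conditional expectation. *)
Lemma keplerian_shear_of_invariant_limit :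
  (forall f, f \in L2 -> exists h, invariant_limit mu g f h) ->
  keplerian_shear mu g.
Proof.
move=> H f fL; have [h [_ hL hi hc]] := H f fL; exists h; last first.
  by split => // t; exact: (Lfun2_flow mpf).
have mh := Lfun2_measurable hL.
split.
- move=> S mS; split; first by rewrite -[X in measurable X]setTI; exact: mh.
  by move=> t; rewrite -comp_preimage hi setYK measure0.
- by apply/Lfun1_integrable; apply: Lfun_subset12 => //; rewrite fin_num_measure.
- move=> A [mA Ainv]; rewrite !ip_indic//.
  have AL : (\1_A : T -> R) \in L2.
    apply: (@Lfun2_bounded _ _ _ _ _ 1); first exact: measurable_indic.
    by move=> x; rewrite indicE normr_nat lern1 leq_b1.
  have E t : ip (f \o g t) \1_A = ip f \1_A.
    rewrite -[RHS](ip_flow mpf t)//; congr fine.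
    have gAL : ((\1_A : T -> R) \o g t) \in L2 by exact: (Lfun2_flow mpf).
    have gfL : f \o g t \in L2 by exact: (Lfun2_flow mpf).
    have mg := Lfun2_measurable gAL.
    apply: ae_eq_integral => //.
    + by apply/measurable_EFinP; exact: measurable_funM (Lfun2_measurable gfL) (Lfun2_measurable AL).
    + by apply/measurable_EFinP; exact: measurable_funM (Lfun2_measurable gfL) mg.
    exists (A `+` g t @^-1` A); split.
    + have mgA : measurable (g t @^-1` A).
        by rewrite -[X in measurable X]setTI; exact: (flow_measurable mpf t).
      by apply: measurableU; exact: measurableD.
    + exact: Ainv.
    + move=> x /= /not_implyP[_]; apply: contra_notP => /= nY.
      congr (_ * _)%:E; rewrite !indicE; congr (_%:R : R); congr nat_of_bool.
      apply/idP/idP => /set_mem xA; apply/mem_set; apply: contrapT => nxA; apply: nY.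
      * by left.
      * by right.
  have c := hc _ AL; rewrite -(cvg_lim _ c)//.
  by under eq_fun do rewrite E; rewrite lim_cst.
Qed.

End shear_criterion.

(** * The circle and the torus *)

Section circle.
Context (R : realType).
Implicit Types (c : circle R) (x y a : R) (m : int).

(** A lift picked by the quotient, with no known regularity: it enters only through functions of
    period 1, or as some lift of a given point. *)
Definition rep c : R := repr c.

Lemma repK c : toCircle (rep c) = c.
Proof. exact: reprK. Qed.

Lemma rep_toCircle x : exists m, rep (toCircle x) = x + m%:~R.
Proof.
have /toCircle_eqP/intrP[m mE] := repK (toCircle x).
by exists m; rewrite -mE addrC subrK.
Qed.

Lemma cos_period m x : cos (x + 2 * pi * m%:~R) = cos x.
Proof.
have H (n : nat) y : cos (y + 2 * pi * n%:R) = cos y.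
  have -> : 2 * pi * n%:R = pi *+ 2 *+ n :> R by rewrite mulr_natl mulr_natr.
  exact: (periodicn (@cosD2pi R)).
case: m => n; first exact: H.
by rewrite NegzE mulrNz mulrN -{2}(subrK (2 * pi * n.+1%:R) x) H.
Qed.

Definition character m a c : R := cos (2 * pi * (m%:~R * rep c) + a).

Lemma character_toCircle m a x :
  character m a (toCircle x) = cos (2 * pi * (m%:~R * x) + a).
Proof.
rewrite /character; have [k ->] := rep_toCircle x.
rewrite -(cos_period (m * k) (2 * pi * (m%:~R * x) + a)) intrM; congr cos; ring.
Qed.

Lemma continuous_cos_affine b a : continuous (fun x : R => cos (b * x + a)).
Proof.
move=> x; apply: (@continuous_comp _ _ _ (fun x => b * x + a) cos); last exact: continuous_cos.
apply: continuousD; last exact: cst_continuous.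
by apply: continuousM; [exact: cst_continuous|].
Qed.

Lemma character_continuous m a : continuous (character m a).
Proof.
apply/quotient_continuous.
rewrite (_ : _ \o _ = (fun x => cos (2 * pi * m%:~R * x + a))).
  exact: continuous_cos_affine.
by apply/funext => x; rewrite -mulrA; exact: character_toCircle.
Qed.

Lemma toCircle_measurable :
  measurable_fun setT (@toCircle R : measurableTypeR R -> borel (circle R)).
Proof.
apply: (@measurability _ _ _ (borel (circle R)) setT _ (@open (circle R))) => //.
move=> _ [V oV <-]; rewrite setTI; apply: open_measurable.
by have /continuousP := @pi_continuous R (Quotient.quot (integers R)); exact.
Qed.

(** A set where a cosine exceeds a threshold is an open arc, possibly empty or the whole circle.
    Rational parameters keep the family countable, and the sign condition is what
    [bounded_closure_pos] handles. *)
Definition arc (q : rat * rat) : set (circle R) :=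
  [set c | ratr q.2 < character 1 (- (2 * pi * ratr q.1)) c].

Lemma open_arc q : open (arc q).
Proof.
have /continuousP/(_ [set r | ratr q.2 < r]) := @character_continuous 1 (- (2 * pi * ratr q.1)).
by apply; exact: open_gt.
Qed.

Lemma arc_basis c (O : set (circle R)) : nbhs c O ->
  exists q, arc q c /\ arc q `<=` O.
Proof.
move=> cO; have : nbhs (rep c) (@toCircle R @^-1` O).
  have := @pi_continuous R (Quotient.quot (integers R)) (rep c) O.
  by apply; rewrite [X in nbhs X O](repK c).
(* The cap keeps [e / 2] within [0, 1/2], where [cos (2 * pi * y)] decreases in [y]. *)
case/nbhs_ballP => e0 /= e00 eO; pose e := Num.min e0 (1/2).
have e_gt0 : 0 < e by rewrite lt_min e00 divr_gt0.
have e_le : e <= 1/2 by rewrite ge_min lexx orbT.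
have e_e0 : e <= e0 by rewrite ge_min lexx.
have pi0 := pi_gt0 R.
have [q1 /itvP q1P] : exists q, ratr q \in `]rep c, rep c + e / 2[%R.
  by have [q qP] := @rat_in_itvoo R (rep c) (rep c + e / 2) (ltr_pwDr (divr_gt0 e_gt0 (ltr0n _ 2)) (lexx _)); exists q.
pose dl := ratr q1 - rep c.
have dl0 : 0 < dl by rewrite subr_gt0 q1P.
have dle : dl < e / 2 by rewrite ltrBlDl q1P.
have cosP y z : 0 <= y <= 1 / 2 -> 0 <= z <= 1 / 2 ->
    (cos (2 * pi * y) < cos (2 * pi * z)) = (z < y).
  move=> /andP[y0 y1] /andP[z0 z1]; rewrite ltr_cos ?in_itv/=.
  - by rewrite ltr_pM2l// mulr_gt0.
  - by rewrite mulr_ge0 ?(ltW pi0)//=; nra.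
  - by rewrite mulr_ge0 ?(ltW pi0)//=; nra.
(* The threshold [q2] is taken between these values: being below the right one puts [c] in the arc,
   being above the left one keeps the arc within [e / 2] of [q1]. *)
have : cos (2 * pi * (e / 2)) < cos (2 * pi * dl).
  by rewrite cosP//; apply/andP; split; lra.
move=> /rat_in_itvoo[q2 /itvP q2P].
have E x : character 1 (- (2 * pi * ratr q1)) (toCircle x) = cos (2 * pi * (ratr q1 - x)).
  by rewrite character_toCircle mul1r -cosN; congr cos; ring.
exists (q1, q2); split.
  by rewrite /arc /= -(repK c) E q2P.
move=> c'; rewrite /arc /= -(repK c') E; set x := rep c' => hx.
(* A nearest integer: the remainder [z] has absolute value at most [1 / 2], so cosines can be
   compared through [|z|]. *)
pose k : int := Num.floor (ratr q1 - x + 1 / 2).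
pose z := ratr q1 - x - k%:~R.
have kE : cos (2 * pi * (ratr q1 - x)) = cos (2 * pi * `|z|).
  rewrite -[in RHS](gtr0_norm (_ : 0 < 2 * pi)) ?mulr_gt0// -normrM cos_norm.
  by rewrite -(cos_period k (2 * pi * z)); congr cos; rewrite /z; ring.
have zb : `|z| <= 1 / 2.
  have : k%:~R <= ratr q1 - x + 1 / 2 by exact: floor_le.
  have : ratr q1 - x + 1 / 2 < (k + 1)%:~R by exact: floorD1_gt.
  by rewrite intrD => ? ?; rewrite /z ler_norml; apply/andP; split; lra.
have : `|z| < e / 2.
  rewrite -cosP; last 2 first.
  - by apply/andP; split; lra.
  - by rewrite normr_ge0.
  - by rewrite -kE; apply: lt_trans hx; rewrite q2P.
rewrite ltr_norml => /andP[z1 z2].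
have -> : toCircle x = toCircle (x + k%:~R).
  by apply/toCircle_eqP; rewrite opprD addNKr rpredN; apply/intrP; exists k.
have zE : z = ratr q1 - x - k%:~R by [].
have dlE : dl = ratr q1 - rep c by [].
by apply: eO; rewrite /ball /= ltr_norml; apply/andP; split; lra.
Qed.

End circle.

(** The antiderivative takes the same value at 0 and 1 because [m] is an integer. *)
Lemma Rintegral_cos_period (R : realType) (m : int) (a : R) : m != 0 ->
  \int[lebesgue_measure]_(x in `[0, 1[) cos (2 * pi * (m%:~R * x) + a) = 0.
Proof.
move=> m0; pose b : R := 2 * pi * m%:~R.
have b0 : b != 0 by rewrite /b mulf_neq0 ?intr_eq0// mulf_neq0// gt_eqF// pi_gt0.
pose F x : R := b^-1 * sin (b * x + a).
have dF (x : R) : is_derive x 1 F (cos (b * x + a)).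
  apply: trigger_derive; rewrite /GRing.scale/=; by field.
have cf := @continuous_cos_affine R b a.
have FF : F 1 = F 0.
  rewrite /F; congr (_ * _); rewrite mulr1 mulr0 add0r -![sin _]cosBpihalf.
  by rewrite -(cos_period m (a - _)) /b; congr cos; ring.
under eq_Rintegral do rewrite mulrA.
have fi : lebesgue_measure.-integrable `[0, 1]%classic (EFin \o (fun x : R => cos (b * x + a))).
  by apply: continuous_compact_integrable; [exact: segment_compact|exact: continuous_subspaceT].
rewrite -/b Rintegral_itv_bndo_bndc; last first.
  by apply: integrableS fi => //; apply: subset_itvl; rewrite bnd_simp.
rewrite /Rintegral (@continuous_FTC2 _ _ F)//.
- by rewrite FF -EFinB subrr.
- exact: continuous_subspaceT.
- split.
  + by move=> x _; case: (dF x).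
  + apply: cvg_at_right_filter; apply: differentiable_continuous.
    by apply/derivable1_diffP; case: (dF 0).
  + apply: cvg_at_left_filter; apply: differentiable_continuous.
    by apply/derivable1_diffP; case: (dF 1).
- by move=> x _; rewrite derive1E; case: (dF x).
Qed.

(** * Trigonometric functions and a countable basis of the torus *)

Section torus.
Context (R : realType).

Definition phase d (xi : 'rV[int]_d) (y : torus R d) : R :=
  \sum_i (xi 0 i)%:~R * rep (y 0 i).

(** A real character with a free phase: translations only change the phase, products split into
    sums, and sines are included. *)
Definition trig d (xi : 'rV[int]_d) (a : R) (y : torus R d) : R :=
  cos (2 * pi * phase xi y + a).

Lemma trig_le1 d (xi : 'rV[int]_d) a y : `|trig xi a y| <= 1.
Proof. exact: cos_max. Qed.

(** In each coordinate the lifts of the two sides differ by an integer, and [xi] is integral, so the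
    angles differ by a multiple of [2 pi]. *)
Lemma trig_translate d (xi : 'rV[int]_d) a y (w : 'rV[R]_d) :
  trig xi a (y + map_mx (@toCircle R) w) =
  trig xi (2 * pi * dotv (map_mx intr xi) w + a) y.
Proof.
have /choice[m mE] : forall i, exists m : int,
    rep ((y + map_mx (@toCircle R) w) 0 i) = rep (y 0 i) + w 0 i + m%:~R.
  move=> i; rewrite !mxE -{1}(repK (y 0 i)) -toCircleD.
  exact: rep_toCircle.
rewrite /trig -(cos_period (\sum_i xi 0 i * m i) (_ + (_ + a))); congr cos.
rewrite addrA -mulrDr /phase /dotv -big_split/= addrAC -mulrDr; congr (2 * pi * _ + a).
rewrite rmorph_sum -big_split /=; apply: eq_bigr => i _.
rewrite mE !mxE intrM; ring.
Qed.

Lemma trigM d (xi eta : 'rV[int]_d) a b y : trig xi a y * trig eta b y =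
  2^-1 * (trig (xi + eta) (a + b) y + trig (xi - eta) (a - b) y).
Proof.
have pD : phase (xi + eta) y = phase xi y + phase eta y.
  by rewrite /phase -big_split /=; apply: eq_bigr => i _; rewrite !mxE intrD mulrDl.
have pB : phase (xi - eta) y = phase xi y - phase eta y.
  by rewrite /phase -sumrB /=; apply: eq_bigr => i _; rewrite !mxE intrB mulrBl.
rewrite /trig pD pB.
have -> : 2 * pi * (phase xi y + phase eta y) + (a + b) =
  (2 * pi * phase xi y + a) + (2 * pi * phase eta y + b) by ring.
have -> : 2 * pi * (phase xi y - phase eta y) + (a - b) =
  (2 * pi * phase xi y + a) - (2 * pi * phase eta y + b) by ring.
by move: (2 * pi * phase xi y + a) (2 * pi * phase eta y + b) => u v; rewrite cosD cosB; field.
Qed.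

Lemma coord_torus_continuous d (i : 'I_d) : continuous (fun y : torus R d => y 0 i).
Proof.
move=> y O yO; exists (fun _ j => if j == i then O else setT).
  by move=> k j; rewrite (ord1 k); case: eqP => [->|_]; [exact: yO|exact: filterT].
by move=> z /(_ 0 i); rewrite eqxx.
Qed.

(** No measurability of [rep], hence of [phase], is at hand. Induction on the coordinates with the
    addition formula expresses the cosine through the continuous functions [character]; the phase
    [- (pi / 2)] stands for the sine. *)
Lemma trig_measurable d (xi : 'rV[int]_d) (a : R) :
  measurable_fun setT (trig xi a : borel (torus R d) -> R).
Proof.
rewrite /trig /phase; elim: (index_enum _) a => [|i s IH] a.
  under eq_fun do rewrite big_nil; exact: measurable_cst.
have mi b : measurable_fun setT (fun y : borel (torus R d) => character (xi 0 i) b (y 0 i)).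
  apply: continuous_borelR => y.
  apply: (@continuous_comp _ _ _ (fun y : torus R d => y 0 i) (character (xi 0 i) b)).
    exact: coord_torus_continuous.
  exact: character_continuous.
have /= := measurable_funB (measurable_funM (mi 0) (IH a))
  (measurable_funM (mi (- (pi / 2))) (IH (a - pi / 2))).
apply: eq_measurable_fun => y _ /=; rewrite big_cons /character.
rewrite addr0 cosBpihalf addrA cosBpihalf -cosD; congr cos; ring.
Qed.

Definition box d (p : 'rV[rat * rat]_d) : set (torus R d) :=
  [set y | forall i, arc (p 0 i) (y 0 i)].

Lemma box_basis d (y : torus R d) (O : set (torus R d)) : nbhs y O ->
  exists p, box p y /\ box p `<=` O.
Proof.
case=> P yP PO.
have /choice[p pP] : forall i, exists q, arc q (y 0 i) /\ arc q `<=` P 0 i.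
  by move=> i; exact: arc_basis.
exists (\row_i p i); split => [i|z zp]; first by rewrite mxE; case: (pP i).
by apply: PO => k i; rewrite (ord1 k); case: (pP i) => _; apply; have := zp i; rewrite mxE.
Qed.

Lemma open_bigcup_box d (O : set (torus R d)) : open O ->
  O = \bigcup_(p in [set p : 'rV[rat * rat]_d | box p `<=` O]) box p.
Proof.
move=> oO; apply/seteqP; split => [y Oy|y [p /= pO /pO]//].
by have [|p [py pO]] := @box_basis _ y O; [exact: open_nbhs_nbhs|exists p].
Qed.

Lemma measurable_box d (p : 'rV[rat * rat]_d) : measurable (box p : set (borel (torus R d))).
Proof.
have -> : box p = \bigcap_(i in [set: 'I_d]) [set y | arc (p 0 i) (y 0 i)].
  by apply/seteqP; split => [y yP i _|y yP i]; [exact: yP|exact: (yP i I)].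
apply: fin_bigcap_measurable => // i _; apply: open_borel.
have /continuousP/(_ (arc (p 0 i))) := @coord_torus_continuous d i.
by apply; exact: open_arc.
Qed.

(** Every open set is a countable union of boxes. This serves maps whose source carries a product
    sigma-algebra rather than a Borel one, such as [torus_cons]. *)
Lemma measurable_torus_box d d' (T : measurableType d') (f : T -> borel (torus R d)) :
  (forall p, measurable (f @^-1` box p)) -> measurable_fun setT f.
Proof.
move=> mbox; apply: (@measurability _ _ _ (borel (torus R d)) setT _ (@open (torus R d))) => //.
move=> _ [V oV <-]; rewrite setTI (open_bigcup_box oV) preimage_bigcup.
rewrite bigcup_mkcond; apply: countable_bigcupT_measurable => [|p]; first exact: countableP.
by case: ifP => _; [exact: mbox|exact: measurable0].
Qed.

End torus.

(** [circle_haar] and [torus_haar] are bare set functions; an equal [probability] gives access to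
    integration and Fubini. *)
Lemma pushforward_probability d1 d2 (X : measurableType d1) (Y : measurableType d2)
    (R : realType) (P : probability X R) (phi : X -> Y) : measurable_fun setT phi ->
  {Q : probability Y R | Q = pushforward P phi :> (set Y -> \bar R)}.
Proof.
move=> mphi.
pose mf : {mfun X >-> Y} := HB.pack phi (isMeasurableFun.Build _ _ _ _ phi mphi).
by exists (distribution P mf).
Qed.

Lemma Rintegral_restricted d (T : measurableType d) (R : realType)
    (m m' : {measure set T -> \bar R}) (D : set T) (f : T -> R) : measurable D ->
  (forall A, measurable A -> m' A = m (A `&` D)) ->
  m'.-integrable setT (EFin \o f) ->
  \int[m']_x f x = \int[m]_(x in D) f x.
Proof.
move=> mD mE fi; congr fine.
have mDC := measurableC mD.
rewrite (@negligible_integral _ _ _ m' setT (~` D) (EFin \o f) mDC measurableT fi).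
  rewrite setTD setCK; apply: eq_measure_integral => A mA AD.
  by rewrite mE// setIidl.
by have := mE _ mDC; rewrite setICl measure0.
Qed.

Lemma probability_integrable d (T : measurableType d) (R : realType)
    (P : {finite_measure set T -> \bar R}) (D : set T) (f : T -> R) (C : R) :
  measurable D -> measurable_fun D f -> (forall x, `|f x| <= C) ->
  P.-integrable D (EFin \o f).
Proof.
move=> mD mf fC; apply: measurable_bounded_integrable => //.
  by rewrite -ge0_fin_numE// fin_num_measure.
exists C; split; first exact: num_real.
by move=> r /ltW Cr x _ /=; exact: le_trans Cr.
Qed.

(** * Haar measure of the torus and orthogonality of characters *)

Section haar.
Context (R : realType).

Let lebesgue_unit := mrestr (@lebesgue_measure R) (measurable_itv `[0 : R, 1[).

HB.instance Definition _ := Measure.on lebesgue_unit.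

Let lebesgue_unit_setT : lebesgue_unit setT = 1%E.
Proof.
rewrite /lebesgue_unit /mrestr setTI.
by rewrite lebesgue_measure_itv/= lte_fin ltr01 -EFinB subr0.
Qed.

HB.instance Definition _ := Measure_isProbability.Build _ _ _ lebesgue_unit
  lebesgue_unit_setT.

Lemma circle_haar_probability :
  {P : probability (borel (circle R)) R | P = @circle_haar R :> (set _ -> \bar R)}.
Proof. exact: (pushforward_probability lebesgue_unit (@toCircle_measurable R)). Qed.

Lemma Rintegral_circle_haar (P : probability (borel (circle R)) R)
    (f : borel (circle R) -> R) (C : R) : P = @circle_haar R :> (set _ -> \bar R) ->
  measurable_fun setT f -> (forall x, `|f x| <= C) ->
  \int[P]_c f c = \int[lebesgue_measure]_(x in `[0, 1[) f (toCircle x).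
Proof.
move=> PE mf fC.
have PE' A : measurable A -> P A = lebesgue_unit (@toCircle R @^-1` A) by rewrite PE.
have fi : P.-integrable setT (EFin \o f) by exact: probability_integrable fC.
rewrite (Rintegral_image (@toCircle_measurable R) PE' mf fi).
apply: Rintegral_restricted => //.
by apply/(integrable_image (@toCircle_measurable R) PE').
Qed.


Definition torus_cons d (p : borel (circle R) * borel (torus R d)) :
  borel (torus R d.+1) := row_mx (const_mx p.1 : torus R 1) p.2 : torus R (1 + d).

Lemma torus_cons0 d p : (@torus_cons d p : torus R d.+1) 0 ord0 = p.1.
Proof.
rewrite /torus_cons; have -> : ord0 = lshift d (ord0 : 'I_1) by exact/val_inj.
by rewrite (row_mxEl (const_mx p.1 : torus R 1)) mxE.
Qed.

Lemma torus_consS d p (i : 'I_d) :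
  (@torus_cons d p : torus R d.+1) 0 (lift ord0 i) = p.2 0 i.
Proof.
rewrite /torus_cons -[RHS](row_mxEr (const_mx p.1 : torus R 1)).
by congr (row_mx _ _ _ _); exact/val_inj.
Qed.

Lemma torus_cons_measurable d : measurable_fun setT (@torus_cons d).
Proof.
apply: (measurable_torus_box (T := (borel (circle R) * borel (torus R d))%type)) => p.
have -> : @torus_cons d @^-1` box p =
    arc (p 0 ord0) `*` box (\row_i p 0 (lift ord0 i)).
  apply/seteqP; split => [y yp|y [y0 y1] i] /=.
    split; first by have := yp ord0; rewrite torus_cons0.
    by move=> i; rewrite mxE; have := yp (lift ord0 i); rewrite torus_consS.
  case: (unliftP ord0 i) => [j ->|->]; last by rewrite torus_cons0.
  by rewrite torus_consS; have := y1 j; rewrite mxE.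
apply: measurableX; last exact: (measurable_box (d := d)).
apply: open_borel; exact: open_arc.
Qed.

Lemma torus_haar_probability d :
  {P : probability (borel (torus R d)) R | P = @torus_haar R d :> (set _ -> \bar R)}.
Proof.
elim: d => [|d [P IH]].
  by exists [the probability _ _ of @dirac _ (borel (torus R 0)) 0 R].
have [Q QE] := circle_haar_probability.
have [S SE] := pushforward_probability [the probability _ _ of (Q \x P)%E] (@torus_cons_measurable d).
by exists S; rewrite SE /= -QE -IH.
Qed.

(** Fubini on the first coordinate, by induction. If the other frequencies are not all zero, the
    first coordinate acts as a mere phase and the inner integral vanishes, which is why [a] is
    arbitrary. Otherwise a one-variable cosine of nonzero frequency remains. *)
Lemma Rintegral_trig d (xi : 'rV[int]_d) (a : R) (P : probability (borel (torus R d)) R) :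
  P = @torus_haar R d :> (set _ -> \bar R) -> xi != 0 ->
  \int[P]_y trig xi a y = 0.
Proof.
elim: d xi a P => [|d IH] xi a P PE xi0.
  by exfalso; move/eqP : xi0; apply; apply/rowP => -[].
have [Q QE] := circle_haar_probability.
have [S SE] := torus_haar_probability d.
have PE' A : measurable A -> P A = (Q \x S)%E (@torus_cons d @^-1` A).
  by rewrite PE /= QE SE.
have mt := @trig_measurable R d.+1 xi a.
have ti : P.-integrable setT (EFin \o (trig xi a)).
  by apply: (@probability_integrable _ _ _ _ _ _ 1) => // y; exact: trig_le1.
rewrite (Rintegral_image (mu := (Q \x S)%E) (@torus_cons_measurable d) PE' mt ti).
have ti' : (Q \x S)%E.-integrable setT (EFin \o (trig xi a \o @torus_cons d)).
  by apply/(integrable_image (@torus_cons_measurable d) PE' mt).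
pose xi' := \row_i xi 0 (lift ord0 i).
have E p : trig xi a (torus_cons p) =
    trig xi' (2 * pi * ((xi 0 ord0)%:~R * rep p.1) + a) p.2.
  rewrite /trig /phase big_ord_recl torus_cons0; congr cos.
  rewrite mulrDr addrAC addrC; congr (_ + _); congr (2 * pi * _).
  by apply: eq_bigr => i _; rewrite torus_consS mxE.
rewrite /Rintegral -(integral12_prod_meas1 ti') /fubini_F.
have [xi'0|xi'0] := eqVneq xi' 0; last first.
  rewrite (eq_integral (cst 0%E)); first by rewrite integral0.
  move=> c _; transitivity ((\int[S]_y trig xi' (2 * pi * ((xi 0 ord0)%:~R * rep c) + a) y)%:E).
    2: by rewrite IH.
  rewrite /Rintegral fineK; last first.
    apply: integrable_fin_num => //.
    by apply: (@probability_integrable _ _ _ _ _ _ 1) => // [|y]; [exact: trig_measurable|exact: trig_le1].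
  by apply: eq_integral => y _; rewrite /= E.
have E' c y : trig xi a (torus_cons (c, y)) = character (xi 0 ord0) a c.
  rewrite E xi'0 /trig /character /phase big1 ?mulr0 ?add0r// => i _.
  by rewrite mxE mul0r.
have x00 : xi 0 ord0 != 0.
  apply: contraNneq xi0 => x0; apply/eqP/rowP => i; rewrite mxE.
  case: (unliftP ord0 i) => [j ->|->//].
  by move/rowP : xi'0 => /(_ j); rewrite !mxE.
rewrite (eq_integral (fun c : borel (circle R) => (character (xi 0 ord0) a c)%:E)); last first.
  move=> c _; under eq_integral do rewrite /= E'.
  by rewrite integral_cst// [X in (_ * X)%E](probability_setT S) mule1.
have := Rintegral_circle_haar QE (continuous_borelR (@character_continuous R (xi 0 ord0) a)) (fun c => cos_max _).
rewrite /Rintegral => ->.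
under [X in fine X]eq_integral do rewrite character_toCircle.
exact: Rintegral_cos_period.
Qed.

End haar.

(** * Bounded closures *)

Section bounded_closure.
Context (T : Type) (R : realType).
Implicit Types f k : T -> R.

(** Functional form of the monotone class argument. As an inductive predicate it transfers to any
    property stable under the same operations, in particular weak convergence of orbits to invariant
    functions. *)
Inductive bounded_closure (D : set (T -> R)) : set (T -> R) :=
| bounded_closure_base f : D f -> bounded_closure D f
| bounded_closureD f k : bounded_closure D f -> bounded_closure D k ->
    bounded_closure D (fun x => f x + k x)
| bounded_closureZ c f : bounded_closure D f -> bounded_closure D (fun x => c * f x)
| bounded_closure_lim (f_ : nat -> T -> R) f (C : R) :
    (forall n, bounded_closure D (f_ n)) -> (forall n x, `|f_ n x| <= C) ->
    (forall x, f_ ^~ x @ \oo --> f x) -> bounded_closure D f.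

Variables (D : set (T -> R)) (S : set T).
Hypothesis D_bounded : forall f, D f -> exists C, forall x, `|f x| <= C.
Hypothesis D_mul : forall f k, D f -> D k -> bounded_closure D (fun x => f x * k x).
Hypothesis D_unit : D \1_S.

Local Notation B := (bounded_closure D).

Lemma bounded_closure_bounded f : B f -> exists C, forall x, `|f x| <= C.
Proof.
elim=> {f} [f /D_bounded//|f k _ [C fC] _ [C' kC]|c f _ [C fC]|f_ f C _ _ fC cf].
- by exists (C + C') => x; rewrite (le_trans (ler_normD _ _))// lerD.
- by exists (`|c| * C) => x; rewrite normrM ler_wpM2l.
- exists C => x; have /cvg_norm cx := cf x; rewrite -(cvg_lim _ cx)//.
  by apply: limr_le; [exact: cvgP cx|exact: nearW].
Qed.

(** Two nested inductions, one per factor; in the limit cases the uniform bound for the products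
    comes from the boundedness of the other factor. *)
Lemma bounded_closureM f k : B f -> B k -> B (fun x => f x * k x).
Proof.
move=> Bf Bk; elim: Bk => {k} [k Dk|k1 k2 _ IH1 _ IH2|c k _ IH|k_ k C Bk IH kC ck].
- elim: Bf => {f} [f Df|f1 f2 _ IH1 _ IH2|c f _ IH|f_ f C _ IH fC cf].
  + exact: D_mul.
  + by under eq_fun do rewrite mulrDl; exact: bounded_closureD.
  + by under eq_fun do rewrite -mulrA; exact: bounded_closureZ.
  + have [K kK] := D_bounded Dk.
    apply: (bounded_closure_lim (C := C * K) IH) => [n x|x].
      by rewrite normrM ler_pM.
    by apply: cvgM => //; exact: cvg_cst.
- by under eq_fun do rewrite mulrDr; exact: bounded_closureD.
- by under eq_fun do rewrite mulrCA; exact: bounded_closureZ.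
- have [K fK] := bounded_closure_bounded Bf.
  apply: (bounded_closure_lim (C := K * C) IH) => [n x|x].
    by rewrite normrM ler_pM.
  by apply: cvgM => //; exact: cvg_cst.
Qed.

(* The odd polynomial [(3 s - s ^ 3) / 2] maps [-1, 1] to itself and its iterates
   converge to the sign of [s]. *)
Let step (s : R) : R := (3 * s - s ^+ 3) / 2.

(** On (0, 1] the iterates increase and stay below 1, as [step u - u = u (1 - u) (1 + u) / 2] and
    [1 - step u = (1 - u)^2 (2 + u) / 2]; the limit is a positive fixed point, hence 1. Oddness
    settles negative [s]. *)
Let iter_step_cvg (s : R) : `|s| <= 1 -> iter n step s @[n --> \oo] --> Num.sg s.
Proof.
have P (r : R) : 0 < r <= 1 -> iter n step r @[n --> \oo] --> (1 : R).
  move=> /andP[r0 r1].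
  have I n : r <= iter n step r <= 1.
    elim: n => [|n /andP[a b]]; first by rewrite lexx.
    rewrite iterS /step; move: (iter n step r) a b => u ru u1.
    have h1 : 0 <= u * ((1 - u) * (1 + u)) by rewrite !mulr_ge0//; lra.
    have h2 : 0 <= (1 - u) * (1 - u) * (2 + u) by rewrite !mulr_ge0//; lra.
    by apply/andP; split; lra.
  have nd : {homo (fun n => iter n step r) : n m / (n <= m)%N >-> n <= m}.
    apply/nondecreasing_seqP => n; rewrite iterS /step.
    have := I n; move: (iter n step r) => u /andP[ru u1].
    have h1 : 0 <= u * ((1 - u) * (1 + u)) by rewrite !mulr_ge0//; lra.
    lra.
  have cv : cvgn (fun n => iter n step r).
    by apply: nondecreasing_is_cvgn => //; exists 1 => _ [n _ <-]; case/andP: (I n).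
  set l := limn (fun n => iter n step r) in cv *.
  have rl : r <= l by apply: limr_ge => //; apply: nearW => n; case/andP: (I n).
  have cl : iter n step r @[n --> \oo] --> l by exact: cv.
  have cS : iter n.+1 step r @[n --> \oo] --> l by rewrite (cvg_shiftS (fun n => iter n step r)).
  have cS' : iter n.+1 step r @[n --> \oo] --> step l.
    rewrite /step; apply: cvgM; last exact: cvg_cst.
    apply: cvgB; first by apply: cvgM => //; exact: cvg_cst.
    by rewrite !exprS expr0; do 2 apply: cvgM => //; rewrite mulr1.
  have /eqP : l = step l by exact: (cvg_unique _ cS cS').
  have l0 : 0 < l by exact: lt_le_trans rl.
  rewrite /step -subr_eq0 (_ : l - _ = l * (l - 1) * (l + 1) / 2); last by field.
  rewrite !mulf_eq0 subr_eq0 (gt_eqF l0) (gt_eqF (_ : 0 < l + 1)) ?addr_gt0//.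
  rewrite invr_eq0 pnatr_eq0 /= !orbF => /eqP l1.
  by rewrite l1 in cl.
have N (r : R) n : iter n step (- r) = - iter n step r.
  by elim: n => //= n ->; rewrite /step; field.
move=> s1; have [s0|s0|->] := ltgtP s 0.
- rewrite ltr0_sg// -[s]opprK; under eq_cvg do rewrite N.
  apply: cvgN; apply: P; rewrite oppr_gt0 s0/=.
  by move: s1; rewrite ltr0_norm.
- by rewrite gtr0_sg//; apply: P; rewrite s0 (le_trans (ler_norm _)).
- rewrite sgr0 (_ : (fun n => _) = cst 0); first exact: cvg_cst.
  apply/funext => n; elim: n => //= n ->.
  by rewrite /step mulr0 expr0n subrr mul0r.
Qed.

Let iter_step_le1 (s : R) n : `|s| <= 1 -> `|iter n step s| <= 1.
Proof.
move=> s1; elim: n => //= n; move: (iter n step s) => u.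
rewrite !ler_norml /step => /andP[? ?].
have h1 : 0 <= (1 + u) * (1 + u) * (2 - u) by rewrite !mulr_ge0//; lra.
have h2 : 0 <= (1 - u) * (1 - u) * (2 + u) by rewrite !mulr_ge0//; lra.
by apply/andP; split; lra.
Qed.

Lemma bounded_closure_pos f : B f -> B \1_[set x | 0 < f x].
Proof.
move=> Bf; have [C0 fC0] := bounded_closure_bounded Bf.
pose C := `|C0| + 1; have C_gt0 : 0 < C by rewrite ltr_wpDl.
have fC x : `|C^-1 * f x| <= 1.
  rewrite normrM normfV (gtr0_norm C_gt0) mulrC ler_pdivrMr// mul1r.
  by rewrite (le_trans (fC0 x))// (le_trans (ler_norm _))// lerDl.
have Biter n : B (fun x => iter n step (C^-1 * f x)).
  elim: n => /= [|n IH]; first exact: bounded_closureZ.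
  have B3 := bounded_closureM (bounded_closureM IH IH) IH.
  have := bounded_closureD (bounded_closureZ (3 / 2) IH) (bounded_closureZ (- 2^-1) B3).
  by congr (B _); apply/funext => x; rewrite /step; field.
have Bsg : B (fun x => Num.sg (f x)).
  apply: (bounded_closure_lim (C := 1) Biter) => [n x|x]; first exact: iter_step_le1.
  have := iter_step_cvg (fC x).
  by rewrite sgrM gtr0_sg ?invr_gt0// mul1r.
(* [(s + s ^+ 2) / 2] sends the signs 1, 0, -1 to 1, 0, 0. *)
have := bounded_closureD (bounded_closureZ 2^-1 Bsg) (bounded_closureZ 2^-1 (bounded_closureM Bsg Bsg)).
congr (B _); apply/funext => x; rewrite indicE.
have -> : (x \in [set x | 0 < f x]) = (0 < f x) by apply/idP/idP => [/set_mem//|?]; exact/mem_set.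
by case: sgrP => _ /=; field.
Qed.

(** The class is given [\1_S] rather than the constant 1 as a unit, so a set is seen only through
    its trace on [S]. *)
Definition closure_set E := B \1_(E `&` S).

Lemma closure_setI E F : closure_set E -> closure_set F -> closure_set (E `&` F).
Proof.
move=> BE BF; have := bounded_closureM BE BF.
by congr (B _); apply/funext => x; rewrite -[LHS]/((\1_(E `&` S) \* \1_(F `&` S)) x) -indicI setIACA setIid.
Qed.

Lemma closure_set_sigma_algebra : sigma_algebra setT closure_set.
Proof.
have CC E : closure_set E -> closure_set (~` E).
  move=> BE; have := bounded_closureD (bounded_closure_base D_unit) (bounded_closureZ (-1) BE).
  congr (B _); apply/funext => x; rewrite !indicE !in_setI in_setC.
  by case: (x \in E); case: (x \in S) => /=; ring.
split.
- rewrite /closure_set set0I indic0.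
  have := bounded_closureZ 0 (bounded_closure_base D_unit).
  by congr (B _); apply/funext => x; rewrite mul0r.
- by move=> A BA; rewrite setTD; exact: CC.
- move=> A BA; rewrite -[X in closure_set X]setCK setC_bigcup; apply/CC.
  (* Finite intersections of complements are reached by products, and their indicators converge
     pointwise, bounded by 1, to that of the countable intersection. *)
  have BN N : closure_set (\bigcap_(i < N) ~` A i).
    elim: N => [|N IH].
      rewrite (_ : \bigcap_(i < 0) ~` A i = setT); last by apply/seteqP; split.
      by rewrite /closure_set setTI; exact: bounded_closure_base.
    rewrite (_ : \bigcap_(i < N.+1) ~` A i = (\bigcap_(i < N) ~` A i) `&` ~` A N).
      by apply: closure_setI => //; exact: CC.
    apply/seteqP; split=> [x xA|x [xA xN] i /=].
      by split=> [i /= iN|]; apply: xA => //=; exact: ltnW.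
    by rewrite ltnS leq_eqVlt => /predU1P[->//|iN]; exact: xA.
  apply: (bounded_closure_lim (C := 1) BN) => [N x|x].
    by rewrite indicE normr_nat lern1 leq_b1.
  apply: cvg_near_cst.
  have [[k _ Ak]|nA] := pselect ((\bigcup_i A i) x).
    exists k.+1 => //= N /= kN; rewrite !indicE !in_setI; congr ((_ && _)%:R).
    by apply/idP/idP => /set_mem xA; exfalso; [exact: (xA k kN)|exact: (xA k I)].
  exists 0%N => //= N _; rewrite !indicE !in_setI; congr ((_ && _)%:R).
  apply/idP/idP => /set_mem _; apply/mem_set => i _ Ai; apply: nA; by exists i.
Qed.

End bounded_closure.

(** * Waves over a chart *)

Lemma open_within_preimage (Y Z : topologicalType) (A : set Y) (f : Y -> Z) (V : set Z) :
  open A -> {within A, continuous f} -> open V -> open (A `&` f @^-1` V).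
Proof.
move=> oA; rewrite continuous_open_subspace// => cf oV.
rewrite openE => x [Ax Vfx]; apply: filterI; first exact: open_nbhs_nbhs.
by apply: cf; [exact/mem_set|exact: open_nbhs_nbhs].
Qed.

Lemma within_continuous_borel (Y Z : ptopologicalType) (A : set Y) (f : Y -> Z) :
  open A -> {within A, continuous f} ->
  measurable_fun (A : set (borel Y)) (f : borel Y -> borel Z).
Proof.
move=> oA cf; apply: (@measurability _ _ (borel Y) (borel Z) A f (@open Z)) => //.
by move=> _ [V oV <-]; apply: open_borel; exact: open_within_preimage.
Qed.

Section rational_box.
Context (R : realType) (n : nat).

Definition rat_box (p : 'rV[rat * rat]_n) : set 'rV[R]_n :=
  [set z | forall i, ratr (p 0 i).1 < z 0 i < ratr (p 0 i).2].

Lemma rat_box_basis (z : 'rV[R]_n) O : nbhs z O -> exists p, rat_box p z /\ rat_box p `<=` O.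
Proof.
case=> P zP PO.
have /choice[p pP] : forall i, exists q : rat * rat,
    ratr q.1 < z 0 i < ratr q.2 /\ [set x : R | ratr q.1 < x < ratr q.2] `<=` P 0 i.
  move=> i; have /nbhs_ballP[e /= e0 eP] := zP 0 i.
  have ze : z 0 i - e < z 0 i by rewrite ltrBlDr ltrDl.
  have ez : z 0 i < z 0 i + e by rewrite ltrDl.
  have [q1 /itvP q1P] := rat_in_itvoo ze; have [q2 /itvP q2P] := rat_in_itvoo ez.
  exists (q1, q2); split=> [|x /= /andP[x1 x2]]; first by rewrite /= q1P q2P.
  have x1' : z 0 i - e < x by rewrite (lt_trans _ x1)// q1P.
  have x2' : x < z 0 i + e by rewrite (lt_trans x2)// q2P.
  by apply: eP; rewrite /ball /= ltr_norml; apply/andP; split; lra.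
exists (\row_i p i); split=> [i|y py]; first by rewrite mxE; case: (pP i).
by apply: PO => k i; rewrite (ord1 k); case: (pP i) => _; apply; have := py i; rewrite mxE.
Qed.

End rational_box.

(** * Waves, their transport by the flow, and the Borel sets they generate *)

Section bundle.
Context (R : realType) (n d : nat) (M Omega : ptopologicalType).
Context (X : C1_manifold R n M) (B : tori_bundle d Omega X).
Context (mu : probability (borel Omega) R) (g : R -> Omega -> Omega).
Context (F : compatible_flow B g).

Local Notation proj := (bundle_proj B).

(** The homeomorphism carries rational boxes back to [U], giving a countable basis of the topology
    inside one chart. *)
Lemma chart_basis U (hU : atlas X U) x (N : set M) : U x -> nbhs x N ->
  exists p, (U `&` chart X U @^-1` rat_box p) x /\ U `&` chart X U @^-1` rat_box p `<=` N.
Proof.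
move=> Ux xN; have [cf cg fK gK [_ ccg]] := chart_homeo hU.
have Vx : (chart X U @` U) (chart X U x) by exists x.
have : nbhs (chart X U x) (chart X U @` U `&` chart_inv X U @^-1` N).
  apply: filterI; first by apply: open_nbhs_nbhs; split => //; exact: chart_open.
  move: ccg; rewrite continuous_open_subspace; last exact: chart_open.
  apply; first exact/mem_set.
  by rewrite fK//; exact/mem_set.
move=> /rat_box_basis[p [px pN]]; exists p; split=> [//|y [Uy py]].
by have [_ /=] := pN _ py; rewrite fK//; exact/mem_set.
Qed.

Lemma measurable_chart_box U (hU : atlas X U) p :
  measurable (U `&` chart X U @^-1` rat_box p : set (borel M)).
Proof.
have [_ _ _ _ [ccf _]] := chart_homeo hU.
have mch := within_continuous_borel (atlas_open hU) ccf.
apply: mch; first exact: (atlas_measurable hU).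
have -> : rat_box p = \bigcap_(i in [set: 'I_n])
    [set z : 'rV[R]_n | ratr (p 0 i).1 < z 0 i < ratr (p 0 i).2].
  by apply/seteqP; split => [y yP i _|y yP i]; [exact: yP|exact: (yP i I)].
apply: fin_bigcap_measurable => // i _.
have := continuous_borelR (@coord_continuous R 1 n 0 i).
move=> /(_ measurableT `]ratr (p 0 i).1, ratr (p 0 i).2[%classic (measurable_itv _)).
by rewrite setTI; congr measurable; apply/seteqP; split => z /=; rewrite in_itv.
Qed.

Definition tor U w : torus R d := (triv B U w).2.

Lemma trivE U (hU : atlas X U) w : U (proj w) -> triv B U w = (proj w, tor U w).
Proof.
move=> Uw; rewrite -(triv_proj hU (mem_set (Uw : (proj @^-1` U) w))) /=.
by rewrite /tor -surjective_pairing.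
Qed.

Lemma triv_flow U (hU : atlas X U) t w : U (proj w) ->
  triv B U (g t w) = (proj w, tor U w + map_mx (@toCircle R) (t *: velocity F U (proj w))).
Proof.
move=> Uw; rewrite -(flowE F hU t (tor U w) Uw) -(trivE hU Uw).
by have [_ _ fK _ _] := triv_homeo B hU; rewrite fK//; exact/mem_set.
Qed.

Lemma proj_flow t w : proj (g t w) = proj w.
Proof.
have : [set: M] (proj w) by [].
rewrite -(atlas_cover X) => -[U hU Uw].
have := triv_proj hU (mem_set (flow_stable F hU t Uw)).
by rewrite /= (triv_flow hU)//= => ->.
Qed.

Lemma tor_flow U (hU : atlas X U) t w : U (proj w) ->
  tor U (g t w) = tor U w + map_mx (@toCircle R) (t *: velocity F U (proj w)).
Proof. by move=> Uw; rewrite /tor triv_flow. Qed.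

Lemma tor_measurable U (hU : atlas X U) :
  measurable_fun (proj @^-1` U : set (borel Omega)) (tor U : borel Omega -> borel (torus R d)).
Proof.
have [_ _ _ _ [ctriv _]] := triv_homeo B hU.
apply: within_continuous_borel.
  by apply: open_comp; [move=> ? _; exact: bundle_proj_continuous|exact: atlas_open hU].
move=> w; apply: (@continuous_comp _ _ _ (triv B U : subspace _ -> _) snd); first exact: ctriv.
exact: cvg_snd.
Qed.

(** The phase [b] depends on the base point, so that composition with the flow yields a wave again;
    [\1_U] hides the values of [tor U] outside the chart, where they mean nothing. *)
Definition wave U (xi : 'rV[int]_d) (h b : borel M -> R) (w : borel Omega) : R :=
  \1_U (proj w) * (h (proj w) * trig xi (b (proj w)) (tor U w)).

Lemma wave_le U xi h b (C : R) w : (forall x, `|h x| <= C) -> `|wave U xi h b w| <= C.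
Proof.
move=> hC; rewrite /wave !normrM indicE normr_nat.
have C0 : 0 <= C by exact: le_trans (hC point).
rewrite -[leRHS]mul1r ler_pM// ?lern1 ?leq_b1// -[leRHS]mulr1 ler_pM//.
exact: trig_le1.
Qed.

Lemma waveM U xi eta h k b c w : wave U xi h b w * wave U eta k c w =
  2^-1 * (wave U (xi + eta) (h \* k) (b \+ c) w + wave U (xi - eta) (h \* k) (b \- c) w).
Proof.
rewrite /wave indicE; case: (_ \in _); rewrite ?mul0r ?mul1r ?addr0 ?mulr0//=.
by rewrite mulrACA trigM; ring.
Qed.

(** An orbit keeps its base point and translates its torus coordinate, which by [trig_translate]
    affects the phase alone. *)
Lemma wave_flow U (hU : atlas X U) xi h b t w : wave U xi h b (g t w) =
  wave U xi h (fun x => 2 * pi * t * frequency F U xi x + b x) w.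
Proof.
rewrite /wave proj_flow indicE.
have [Uw|nU] := pselect (U (proj w)); last first.
  by rewrite memNset// !mul0r.
rewrite mem_set// tor_flow// trig_translate /frequency; congr (_ * (_ * trig _ (_ + _) _)).
rewrite /dotv !mulr_sumr; apply: eq_bigr => i _; rewrite !mxE; ring.
Qed.

Lemma proj_measurable d' (T : measurableType d') (h : borel M -> T) :
  measurable_fun setT h -> measurable_fun setT (fun w : borel Omega => h (proj w)).
Proof. by move=> mh; exact: (measurableT_comp mh (mproj_measurable B)). Qed.

Lemma wave_measurable U (hU : atlas X U) xi h b :
  measurable_fun setT h -> measurable_fun (U : set (borel M)) b ->
  measurable_fun setT (wave U xi h b).
Proof.
move=> mh mb; have mS := preimage_atlas_measurable B hU.
have -> : wave U xi h b = (fun w => h (proj w) * trig xi (b (proj w)) (tor U w)) \_ (proj @^-1` U).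
  apply/funext => w; rewrite /wave patchE indicE.
  rewrite (_ : (w \in proj @^-1` U) = (proj w \in U)); last first.
    by apply/idP/idP => /set_mem ?; exact/mem_set.
  by case: (_ \in _); rewrite ?mul1r ?mul0r.
apply/(measurable_restrictT _ mS).
have mp := mproj_measurable B.
have mbp : measurable_fun (proj @^-1` U : set (borel Omega)) (fun w : borel Omega => b (proj w)).
  apply: (@measurable_comp _ _ _ _ _ _ (U : set (borel M)) b) => //.
  - exact: (atlas_measurable hU).
  - by move=> _ [w Uw <-].
  - exact: measurable_funS mp.
have mt c : measurable_fun (proj @^-1` U : set (borel Omega)) (fun w : borel Omega => trig xi c (tor U w)).
  exact: (measurableT_comp (@trig_measurable R d xi c) (tor_measurable hU)).
have mcos (f : R -> R) : continuous f ->
    measurable_fun (proj @^-1` U : set (borel Omega)) (fun w : borel Omega => f (b (proj w))).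
  by move=> cf; exact: (measurableT_comp (continuous_measurable_fun cf) mbp).
apply: measurable_funM.
  by apply: measurable_funS (proj_measurable mh).
(* [trig xi c] is known to be measurable for constant [c]; the addition formula separates the
   variable phase from the torus coordinate. *)
have := measurable_funB (measurable_funM (mt 0) (mcos _ (@continuous_cos R)))
  (measurable_funM (mt (- (pi / 2))) (mcos _ (@continuous_sin R))).
apply: eq_measurable_fun => w _ /=.
by rewrite /trig addr0 cosBpihalf -cosD.
Qed.

Definition waves U : set (borel Omega -> R) :=
  [set f | exists xi (h : borel M -> R) a (C : R),
    [/\ measurable_fun setT h, forall x, `|h x| <= C & f = wave U xi h (cst a)]].

Lemma waves_indic U (hU : atlas X U) (A : set (borel M)) : measurable A ->
  waves U \1_(proj @^-1` A `&` proj @^-1` U).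
Proof.
move=> mA; exists 0, \1_A, 0, 1; split.
- exact: measurable_indic.
- by move=> x; rewrite indicE normr_nat lern1 leq_b1.
- apply/funext => w; rewrite /wave /trig /phase big1 ?mulr0 ?add0r ?cos0; last first.
    by move=> i _; rewrite mxE mul0r.
  by rewrite !indicE in_setI mulr1 andbC -mulnb natrM.
Qed.

Lemma waves_mul U f k : waves U f -> waves U k -> bounded_closure (waves U) (fun w => f w * k w).
Proof.
move=> [xi [h [a [C [mh hC ->]]]]] [eta [k' [c [C' [mk kC ->]]]]].
have mhk := measurable_funM mh mk.
have hkC x : `|(h \* k') x| <= C * C' by rewrite normrM ler_pM.
under eq_fun do rewrite waveM.
apply: bounded_closureZ; apply: bounded_closureD; apply: bounded_closure_base.
  by exists (xi + eta), (h \* k'), (a + c), (C * C').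
by exists (xi - eta), (h \* k'), (a - c), (C * C').
Qed.

Lemma waves_bounded U f : waves U f -> exists C : R, forall w, `|f w| <= C.
Proof. by move=> [xi [h [a [C [mh hC ->]]]]]; exists C => w; exact: wave_le. Qed.

(** [closure_set] is a sigma-algebra, so open sets suffice, and over [U] these are countable unions
    of cylinders. The base of a cylinder is a wave with [xi = 0]; the arc in coordinate [i] is where
    a wave of frequency [delta_mx 0 i] exceeds a constant. *)
Lemma waves_closure_set U (hU : atlas X U) (E : set (borel Omega)) :
  measurable E -> closure_set (waves U) (proj @^-1` U) E.
Proof.
have unit : waves U \1_(proj @^-1` U).
  by have := waves_indic hU measurableT; rewrite preimage_setT setTI.
have sa := closure_set_sigma_algebra (@waves_bounded U) (@waves_mul U) unit.
have [_ saC sacup] := sa.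
suff H : @open Omega `<=` closure_set (waves U) (proj @^-1` U).
  by move: E; apply: smallest_sub.
move=> O oO.
(* The set [O] read in the coordinates of the trivialization. *)
pose W := (U `*` setT) `&` triv_inv B U @^-1` O.
have [tf ti tK iK [_ cti]] := triv_homeo B hU.
have oW : open W.
  apply: open_within_preimage => //; rewrite openE => -[x y] [/= Ux _].
  exists (U, setT) => /=; last by case=> ? ? [].
  by split; [exact: open_nbhs_nbhs (conj (atlas_open hU) Ux)|exact: filterT].
pose I := [set pq : 'rV[rat * rat]_n * 'rV[rat * rat]_d |
  (U `&` chart X U @^-1` rat_box pq.1) `*` box pq.2 `<=` W].
(* The box condition is spread over the list [enum 'I_d] so that an induction can add one arc at a
   time. *)
pose cyl (pq : 'rV[rat * rat]_n * 'rV[rat * rat]_d) : set Omega := (proj @^-1` (U `&` chart X U @^-1` rat_box pq.1))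
  `&` [set w | forall i, i \in enum 'I_d -> arc (pq.2 0 i) (tor U w 0 i)].
have mcyl pq : closure_set (waves U) (proj @^-1` U) (cyl pq).
  apply: (closure_setI (@waves_bounded U) (@waves_mul U)).
    by apply: bounded_closure_base; apply: waves_indic => //; exact: measurable_chart_box.
  elim: (enum 'I_d) => [|i s IH].
    by rewrite (_ : [set w | _] = setT); [rewrite /closure_set setTI; exact: bounded_closure_base|apply/seteqP; split].
  rewrite (_ : [set w | _] = [set w | arc (pq.2 0 i) (tor U w 0 i)] `&`
      [set w | forall j, j \in s -> arc (pq.2 0 j) (tor U w 0 j)]); last first.
    apply/seteqP; split => [w H|w [H1 H2] j].
      by split=> [|j js]; apply: H; rewrite inE ?eqxx// js orbT.
    by rewrite inE => /predU1P[->//|]; exact: H2.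
  apply: (closure_setI (@waves_bounded U) (@waves_mul U)) => //.
  pose q := pq.2 0 i; pose a : R := - (2 * pi * ratr q.1).
  have Bf : bounded_closure (waves U) (fun w => wave U (delta_mx 0 i) (cst 1) (cst a) w
      + (- ratr q.2) * \1_(proj @^-1` U) w).
    apply: bounded_closureD; last by apply: bounded_closureZ; exact: bounded_closure_base.
    apply: bounded_closure_base; exists (delta_mx 0 i), (cst 1), a, 1; split => // x.
    by rewrite normr1.
  have := bounded_closure_pos (@waves_bounded U) (@waves_mul U) Bf.
  congr (bounded_closure _ \1_ _); apply/seteqP.
  have tE w : trig (delta_mx 0 i) a (tor U w) = character 1 a (tor U w 0 i).
    rewrite /trig /character /phase (bigD1 i)//= big1 ?addr0 => [|j ji].
      by rewrite mxE !eqxx.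
    by rewrite mxE (negbTE ji) mul0r.
  have fE w : wave U (delta_mx 0 i) (cst 1) (cst a) w + (- ratr q.2) * \1_(proj @^-1` U) w =
      (proj w \in U)%:R * (character 1 a (tor U w 0 i) - ratr q.2).
    by rewrite /wave /= tE !indicE (_ : (w \in proj @^-1` U) = (proj w \in U))//; ring.
  split=> w; rewrite /= fE.
    case: (boolP (proj w \in U)) => [/set_mem Uw|_]; last by rewrite mul0r ltxx.
    by rewrite mul1r subr_gt0.
  by move=> [aw Uw]; rewrite (mem_set (Uw : U (proj w))) mul1r subr_gt0.
(* An enumeration of the cylinders contained in [O], padded with empty sets. *)
pose A n := if unpickle n is Some pq then (if pq \in I then cyl pq else set0) else set0.
have mA k : closure_set (waves U) (proj @^-1` U) (A k).
  rewrite /A; case: unpickle => [pq|]; last by case: sa.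
  by case: ifPn => // _; case: sa.
have := sacup _ mA; congr (bounded_closure _ \1_ _); apply/seteqP; split => w [].
  move=> [k _]; rewrite /A; case: unpickle => // pq.
  case: ifPn => // /set_mem IE [Ew Tw] Uw; split => //.
  have : W (proj w, tor U w).
    by apply: IE; split => //= i; apply: Tw; rewrite mem_enum.
  by move=> [_ /=]; rewrite -(trivE hU Uw) tK//; exact/mem_set.
move=> Ow Uw; split => //.
have : nbhs (proj w, tor U w) W.
  apply: open_nbhs_nbhs; split => //; split => //=.
  by rewrite -(trivE hU Uw) tK//; exact/mem_set.
move=> [[N V] /= [xN yV] NVW].
have [p [pw pN]] := chart_basis hU Uw xN.
have [q [qy qV]] := box_basis yV.
exists (pickle (p, q)) => //; rewrite /A pickleK ifT.
  by split => // i _; exact: qy.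
by apply/mem_set => -[x y] /= [xp yq]; apply: NVW; split => /=; [exact: pN|exact: qV].
Qed.

End bundle.

(** * Integrals and correlations of waves *)

Section wave_integrals.
Context (R : realType) (n d : nat) (M Omega : ptopologicalType).
Context (X : C1_manifold R n M) (B : tori_bundle d Omega X).
Context (mu : probability (borel Omega) R) (g : R -> Omega -> Omega).
Context (F : compatible_flow B g).
Hypothesis mu_compat : compatible_measure B mu.

Local Notation proj := (bundle_proj B).
Local Notation ip := (inner mu).

(** Over [U], compatibility turns [mu] into base measure times Haar measure. By Fubini the inner
    integral is that of [trig xi] with the phase frozen at [b x], which is 0. *)
Lemma Rintegral_wave U (hU : atlas X U) xi (h b : borel M -> R) (C : R) : xi != 0 ->
  measurable_fun setT h -> (forall x, `|h x| <= C) -> measurable_fun setT b ->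
  \int[mu]_w wave B U xi h b w = 0.
Proof.
move=> xi0 mh hC mb.
have mS := preimage_atlas_measurable B hU; have mU := atlas_measurable hU.
have [P PE] := torus_haar_probability R d.
pose baseU := restriction (base_measure B mu) mU.
pose muS := restriction mu mS.
pose Phi (p : borel M * borel (torus R d)) := h p.1 * trig xi (b p.1) p.2.
(* Extending the torus coordinate by 0 off the chart makes [phi] measurable everywhere; it agrees
   with [triv B U] over [U], where [muS] is concentrated. *)
pose phi (w : borel Omega) : borel M * borel (torus R d) :=
  (proj w, ((tor B U : borel Omega -> borel (torus R d)) \_ (proj @^-1` U)) w).
have mPhi : measurable_fun setT Phi.
  have mt c : measurable_fun setT (fun p : borel M * borel (torus R d) => trig xi c p.2).
    exact: (measurableT_comp (@trig_measurable R d xi c) measurable_snd).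
  have mb1 : measurable_fun setT (fun p : borel M * borel (torus R d) => b p.1).
    exact: (measurableT_comp mb measurable_fst).
  have mcos (f : R -> R) : continuous f ->
      measurable_fun setT (fun p : borel M * borel (torus R d) => f (b p.1)).
    by move=> cf; exact: (measurableT_comp (continuous_measurable_fun cf) mb1).
  apply: measurable_funM; first exact: (measurableT_comp mh measurable_fst).
  have := measurable_funB (measurable_funM (mt 0) (mcos _ (@continuous_cos R)))
    (measurable_funM (mt (- (pi / 2))) (mcos _ (@continuous_sin R))).
  by apply: eq_measurable_fun => p _ /=; rewrite /trig addr0 cosBpihalf -cosD.
have mphi : measurable_fun setT phi.
  apply/measurable_fun_pair => /=; first exact: (mproj_measurable B).
  apply/(measurable_restrictT _ mS).
  exact: tor_measurable.
have phiE w : U (proj w) -> phi w = triv B U w.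
  by move=> Uw; rewrite /phi (trivE hU Uw) patchE ifT//; exact/mem_set.
have nuE A : measurable A -> (baseU \x P)%E A = muS (phi @^-1` A).
  move=> mA; rewrite -[LHS]/((mrestr (base_measure B mu) mU \x P)%E A) PE -(mu_compat hU mA).
  congr (mu _); apply/seteqP; split => w [Aw Uw]; split => //.
    by rewrite /= phiE.
  by move: Aw; rewrite /= phiE.
have Phi_le p : `|Phi p| <= C.
  by rewrite /Phi normrM -[leRHS]mulr1 ler_pM//; exact: trig_le1.
have PhiI : (baseU \x P)%E.-integrable setT (EFin \o Phi).
  apply/(integrable_image mphi nuE mPhi).
  apply: (@probability_integrable _ _ _ _ _ _ C) => [//||w]; last exact: Phi_le.
  exact: measurableT_comp.
have := Rintegral_image mphi nuE mPhi PhiI.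
rewrite (@Rintegral_restricted _ _ _ mu muS (proj @^-1` U)) //; last first.
  exact/(integrable_image mphi nuE mPhi).
rewrite [in X in _ = X -> _]Rintegral_mkcond => H.
transitivity (\int[(baseU \x P)%E]_y Phi y).
  rewrite H; apply: eq_Rintegral => w _; rewrite /wave patchE indicE.
  rewrite (_ : (w \in proj @^-1` U) = (proj w \in U))//.
  case: (boolP (proj w \in U)) => [/set_mem Uw|_]; last by rewrite mul0r.
  by rewrite mul1r /Phi phiE// (trivE hU Uw).
rewrite /Rintegral -(integral12_prod_meas1 PhiI) /fubini_F.
rewrite (eq_integral (cst 0%E)) ?integral0// => x _ /=.
have E0 := Rintegral_trig (b x) PE xi0.
have ti : P.-integrable setT (EFin \o trig xi (b x)).
  apply: (@probability_integrable _ _ _ _ _ _ 1) => // [|y]; last exact: trig_le1.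
  exact: trig_measurable.
have -> : (\int[P]_y (Phi (x, y))%:E = (\int[P]_y Phi (x, y))%:E)%E.
  rewrite /Rintegral fineK//; apply: integrable_fin_num => //.
  exact: (integrableZl measurableT (h x) ti).
by rewrite /Phi /= RintegralZl// E0 mulr0.
Qed.

Section chart.
Context (U : set M) (hU : atlas X U) (xi : 'rV[int]_d).

(** Velocities are controlled only on [U]. The default 0 makes the frequency globally measurable and
    puts the complement of [U] among the zero frequencies, which are discarded later. *)
Definition chart_frequency : borel M -> R := frequency F U xi \_ U.

Lemma freq_measurable : measurable_fun setT chart_frequency.
Proof.
apply/(measurable_restrictT _ (atlas_measurable hU)).
exact: (frequency_measurable F hU xi).
Qed.

Lemma wave_freq_flow (h b : borel M -> R) t : wave B U xi h b \o g t =
  wave B U xi h (fun x => 2 * pi * t * chart_frequency x + b x).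
Proof.
apply/funext => w; rewrite /= (wave_flow F)// /wave indicE.
case: (boolP (proj w \in U)) => [Uw|_]; last by rewrite !mul0r.
by rewrite /chart_frequency patchE Uw.
Qed.

(** The product of the two waves splits into frequencies [xi + xi] and [xi - xi]: the first is
    nonzero and integrates to 0, the second leaves a function of the base alone. *)
Lemma ip_wave (h k : borel M -> R) a c t (C : R) : xi != 0 ->
  measurable_fun setT h -> (forall x, `|h x| <= C) ->
  measurable_fun setT k -> (forall x, `|k x| <= C) ->
  ip (wave B U xi h (cst a) \o g t) (wave B U xi k (cst c)) =
  2^-1 * \int[mu]_w (\1_U (proj w) * (h (proj w) * k (proj w)
            * cos (2 * pi * t * chart_frequency (proj w) + (a - c)))).
Proof.
move=> xi0 mh hC mk kC; rewrite wave_freq_flow /inner.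
under eq_Rintegral do rewrite waveM.
have mhk := measurable_funM mh mk.
have hkC x : `|(h \* k) x| <= C * C by rewrite normrM ler_pM.
have maff e : measurable_fun setT (fun x => 2 * pi * t * chart_frequency x + e).
  apply: measurable_funD => //; apply: measurable_funM => //; exact: freq_measurable.
have wi eta b : measurable_fun setT b ->
    mu.-integrable setT (EFin \o wave B U eta (h \* k) b).
  move=> mb; apply: (@probability_integrable _ _ _ _ _ _ (C * C)) => //.
    by apply: wave_measurable => //; exact: measurable_funTS.
  by move=> w; exact: wave_le.
have m1 := maff (a + c); have m2 := maff (a - c).
have E1 : (fun x => 2 * pi * t * chart_frequency x + cst a x) \+ cst c = (fun x => 2 * pi * t * chart_frequency x + (a + c)).
  by apply/funext => x /=; rewrite addrA.
have E2 : (fun x => 2 * pi * t * chart_frequency x + cst a x) \- cst c = (fun x => 2 * pi * t * chart_frequency x + (a - c)).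
  by apply/funext => x /=; rewrite addrA.
rewrite RintegralZl//; last first.
  rewrite E1 E2; apply: (@integrableD _ _ _ _ _ _ (EFin \o _) (EFin \o _)) => //; exact: wi.
rewrite E1 E2 RintegralD//; try exact: wi.
rewrite (Rintegral_wave hU (C := C * C))// ?add0r; last first.
  apply: contraNneq xi0 => /rowP H; apply/eqP/rowP => i.
  by apply/eqP; have /eqP := H i; rewrite !mxE -mulr2n mulrn_eq0.
congr (_ * _); apply: eq_Rintegral => w _; rewrite /wave subrr.
by rewrite /trig /phase big1 ?mulr0 ?add0r// => i _; rewrite mxE mul0r.
Qed.

End chart.

End wave_integrals.

Lemma measurable_neq0 d (T : measurableType d) (R : realType) (f : T -> R) :
  measurable_fun setT f -> measurable_fun setT (fun x => (f x != 0)%:R : R).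
Proof.
move=> mf; rewrite (_ : (fun x => _) = \1_[set~ 0] \o f).
  by apply: measurableT_comp => //; apply: measurable_indic; exact: measurable_nonzero.
apply/funext => x; rewrite /= indicE; congr (_%:R : R); congr nat_of_bool.
by apply/idP/idP => [/eqP fx|/set_mem fx]; [exact/mem_set|exact/eqP].
Qed.

(** * Oscillating integrals and the Fourier transform of the frequency measure *)

Section fourier.
Context (R : realType) (n d : nat) (M Omega : ptopologicalType).
Context (X : C1_manifold R n M) (B : tori_bundle d Omega X).
Context (mu : probability (borel Omega) R) (g : R -> Omega -> Omega).
Context (F : compatible_flow B g).
Context (U : set M) (hU : atlas X U) (xi : 'rV[int]_d).

Local Notation proj := (bundle_proj B).
Local Notation ip := (inner mu).
Local Notation freq := (chart_frequency F U xi).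

(** For [a = 0], the real part of the Fourier transform of [h] times the restricted frequency
    measure, pulled back to [Omega]; [a = - (pi / 2)] gives the imaginary part. *)
Definition oscillation (h : R -> R) (t a : R) : R := \int[mu]_w
  ((freq (proj w) != 0)%:R * (h (freq (proj w)) * cos (2 * pi * t * freq (proj w) + a))).

Let mphi : measurable_fun setT (fun w : borel Omega => freq (proj w)).
Proof. by apply: proj_measurable; exact: freq_measurable. Qed.

Lemma freq_out x : ~ U x -> freq x = 0.
Proof. by move=> nU; rewrite /chart_frequency patchE memNset. Qed.

(** Extending the frequency by 0 off [U] changes its law only at 0, a point that the restriction
    removes. *)
Lemma Rintegral_frequency (f : R -> R) (C : R) : measurable_fun setT f ->
  (forall x, `|f x| <= C) ->
  \int[restriction (frequency_measure F mu hU xi) (measurable_nonzero R)]_x f x =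
  \int[mu]_w ((freq (proj w) != 0)%:R * f (freq (proj w))).
Proof.
move=> mf fC; have [Q QE] := @pushforward_probability _ _ _ (measurableTypeR R) _ mu _ mphi.
have m0 := measurable_nonzero R.
transitivity (\int[Q]_(x in [set~ 0]) f x).
  apply: (Rintegral_restricted m0) => [A mA|]; last first.
    by apply: (@probability_integrable _ _ _ _ _ _ C).
  apply: etrans (esym (congr1 (fun m : set R -> \bar R => m (A `&` [set~ 0])) QE)).
  congr (mu _); apply/seteqP; split => w /=.
    move=> [[Aw w0] Uw].
    have E : freq (proj w) = frequency F U xi (proj w) by rewrite /chart_frequency patchE mem_set.
    by rewrite /preimage /= E.
  move=> [Aw w0]; have Uw : U (proj w).
    by apply: contrapT => nU; apply: w0; exact: freq_out.
  have E : freq (proj w) = frequency F U xi (proj w) by rewrite /chart_frequency patchE mem_set.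
  by rewrite /preimage /= E in Aw w0.
rewrite Rintegral_mkcond.
have QE' A : measurable A -> Q A = mu ((fun w => freq (proj w)) @^-1` A) by rewrite QE.
have mf0 : measurable_fun setT (f \_ [set~ 0]).
  by apply/(measurable_restrictT _ m0); exact: measurable_funTS.
have mphi' : measurable_fun setT ((fun w => freq (proj w)) : borel Omega -> measurableTypeR R) := mphi.
rewrite (Rintegral_image mphi' QE' mf0).
  apply: eq_Rintegral => w _; rewrite patchE.
  case: (eqVneq (freq (proj w)) 0) => [->|w0] /=.
    by rewrite memNset ?mul0r//= => H; exact: H.
  by rewrite mem_set ?mul1r//=; exact/eqP.
apply: (@probability_integrable _ _ _ _ _ _ `|C|) => // x.
rewrite patchE; case: ifP => _; last by rewrite normr0.
exact: le_trans (fC x) (ler_norm _).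
Qed.

Let mcos t a : measurable_fun setT (fun z : R => cos (2 * pi * t * z + a)).
Proof. exact: continuous_measurable_fun (@continuous_cos_affine R _ _). Qed.

Lemma fourier_osc t :
  fourier (restriction (frequency_measure F mu hU xi) (measurable_nonzero R)) t =
  (oscillation (cst 1) t 0 +i* oscillation (cst 1) t (- (pi / 2)))%C.
Proof.
have H a : \int[restriction (frequency_measure F mu hU xi) (measurable_nonzero R)]_x
    cos (2 * pi * t * x + a) = oscillation (cst 1) t a.
  rewrite (@Rintegral_frequency _ 1)//; last by move=> x; exact: cos_max.
  by apply: eq_Rintegral => w _; rewrite mul1r.
rewrite /fourier /complex_integral /= -!H; congr (_ +i* _)%C; apply: eq_Rintegral => x _.
  by rewrite addr0.
by rewrite cosBpihalf.
Qed.

Definition rotating : borel M -> R := fun x => (freq x != 0)%:R.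

Lemma rot_measurable : measurable_fun setT rotating.
Proof.
exact: (measurable_neq0 (freq_measurable F hU xi)).
Qed.

Lemma rot_le1 x : `|rotating x| <= 1.
Proof. by rewrite /rotating normr_nat lern1 leq_b1. Qed.

Lemma rotM x : rotating x * rotating x = rotating x.
Proof. by rewrite /rotating; case: (_ != _); rewrite ?mulr1 ?mulr0. Qed.

Lemma osc_integrable (h : R -> R) (C : R) t a : measurable_fun setT h ->
  (forall x, `|h x| <= C) -> mu.-integrable setT (fun w => ((freq (proj w) != 0)%:R *
    (h (freq (proj w)) * cos (2 * pi * t * freq (proj w) + a)))%:E).
Proof.
move=> mh hC; apply: (@probability_integrable _ _ _ _ _ _ C) => [//||w]; last first.
  rewrite normrM normr_nat -[leRHS]mul1r ler_pM// ?lern1 ?leq_b1//.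
  by rewrite normrM -[leRHS]mulr1 ler_pM// cos_max.
apply: measurable_funM; first exact: (measurableT_comp rot_measurable (mproj_measurable B)).
apply: measurable_funM; first exact: (measurableT_comp mh mphi).
exact: (measurableT_comp (mcos t a) mphi).
Qed.

Lemma osc_neg t a : oscillation (cst 1) (- t) a = oscillation (cst 1) t (- a).
Proof.
apply: eq_Rintegral => w _; rewrite -[in RHS]cosN; congr (_ * (_ * cos _)); ring.
Qed.

Lemma osc_negpi t a : oscillation (cst 1) t (a + pi) = - oscillation (cst 1) t a.
Proof.
rewrite /oscillation -mulN1r -RintegralZl//; last first.
  by apply: (@osc_integrable (cst 1) 1) => // x; rewrite normr1.
by apply: eq_Rintegral => w _; rewrite addrA cosDpi; ring.
Qed.

(** The measure is real, so its transform at [- t] is conjugate to that at [t], and decay at [+oo]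
    of both parts yields decay at [-oo]. *)
Lemma rajchman_osc :
  rajchman (restriction (frequency_measure F mu hU xi) (measurable_nonzero R)) <->
  forall a, a = 0 \/ a = - (pi / 2) -> oscillation (cst 1) t a @[t --> +oo] --> 0.
Proof.
split=> [[+ _] a aE|H].
  move=> H; apply/norm_cvg0P; apply: (squeeze_cvgr _ (cvg_cst 0) H).
  apply: nearW => t; rewrite normr_ge0 fourier_osc /= -sqrtr_sqr ler_wsqrtr//.
  by case: aE => ->; rewrite ?lerDl ?lerDr sqr_ge0.
have c0 := H 0 (or_introl erefl); have c1 := H _ (or_intror erefl).
have cS : Num.sqrt (oscillation (cst 1) t 0 ^+ 2 + oscillation (cst 1) t (- (pi / 2)) ^+ 2) @[t --> +oo] --> (0 : R).
  rewrite -[X in _ --> X]sqrtr0; apply: continuous_cvg; first exact: sqrt_continuous.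
  rewrite -[X in _ --> X]addr0; apply: cvgD.
    by rewrite -[X in _ --> X](mulr0 0); under eq_fun do rewrite expr2; exact: cvgM.
  by rewrite -[X in _ --> X](mulr0 0); under eq_fun do rewrite expr2; exact: cvgM.
have cN : Num.sqrt (oscillation (cst 1) t 0 ^+ 2 + (- oscillation (cst 1) t (- (pi / 2))) ^+ 2) @[t --> +oo] --> (0 : R).
  by apply: cvg_trans cS; apply: near_eq_cvg; apply: nearW => t; rewrite sqrrN.
split.
  by apply: cvg_trans cS; apply: near_eq_cvg; apply: nearW => t; rewrite fourier_osc.
apply/cvgNy_compNP; apply: cvg_trans cN; apply: near_eq_cvg; apply: nearW => t.
rewrite -[RHS]/(ComplexField.Normc.normc (fourier (restriction (frequency_measure F mu hU xi) (measurable_nonzero R)) (- t))).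
by rewrite fourier_osc /= !osc_neg oppr0 opprK -osc_negpi; congr (Num.sqrt (_ + oscillation _ _ _ ^+ 2)); field.
Qed.

Hypothesis mu_compat : compatible_measure B mu.

(** [rotating] is idempotent, so its presence in both waves amounts to one restriction to nonzero
    frequencies. [1 <= C] lets a single constant bound both amplitudes. *)
Lemma ip_wave_osc (h : R -> R) (C : R) a c t : xi != 0 -> 1 <= C ->
  measurable_fun setT h -> (forall x, `|h x| <= C) ->
  ip (wave B U xi (fun x => h (freq x) * rotating x) (cst a) \o g t) (wave B U xi rotating (cst c)) =
  2^-1 * oscillation h t (a - c).
Proof.
move=> xi0 C1 mh hC.
have mhf : measurable_fun setT (fun x => h (freq x) * rotating x).
  apply: measurable_funM; last exact: rot_measurable.
  exact: (measurableT_comp mh (freq_measurable F hU xi)).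
rewrite (ip_wave F mu_compat hU _ _ _ xi0 mhf _ rot_measurable (C := C))//.
- congr (_ * _); apply: eq_Rintegral => w _.
  rewrite -(mulrA (h _)) rotM.
  rewrite indicE; case: (boolP (proj w \in U)) => [_|nU]; first by rewrite mul1r /rotating; ring.
  have f0 : freq (proj w) = 0 by apply: freq_out => Uw; rewrite mem_set in nU.
  by rewrite /rotating f0 eqxx !mul0r.
- move=> x; rewrite normrM -[leRHS]mulr1 ler_pM//; exact: rot_le1.
- by move=> x; rewrite (le_trans (rot_le1 x)).
Qed.

End fourier.

(** * Keplerian shear and the Rajchman property *)

Section shear_to_rajchman.
Context (R : realType) (n d : nat) (M Omega : ptopologicalType).
Context (X : C1_manifold R n M) (B : tori_bundle d Omega X).
Context (mu : probability (borel Omega) R) (g : R -> Omega -> Omega).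
Context (F : compatible_flow B g).
Context (U : set M) (hU : atlas X U) (xi : 'rV[int]_d).

Local Notation proj := (bundle_proj B).
Local Notation freq := (chart_frequency F U xi).
Local Notation osc := (oscillation mu F U xi).

Let mphi : measurable_fun setT (fun w : borel Omega => freq (proj w)).
Proof. exact: (measurableT_comp (freq_measurable F hU xi) (mproj_measurable B)). Qed.

(** The bound does not involve [t], which allows a limit of amplitudes to be exchanged with [t]
    tending to infinity. *)
Lemma osc_dist (h k : R -> R) (C : R) t a : measurable_fun setT h ->
  measurable_fun setT k -> (forall x, `|h x| <= C) -> (forall x, `|k x| <= C) ->
  `|osc h t a - osc k t a| <=
    norm2 mu (fun w => h (freq (proj w)) - k (freq (proj w))).
Proof.
move=> mh mk hC kC.
have ih := osc_integrable mu F hU xi t a mh hC.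
have ik := osc_integrable mu F hU xi t a mk kC.
have mhk : measurable_fun setT (fun w : borel Omega => h (freq (proj w)) - k (freq (proj w))).
  by apply: measurable_funB; [exact: (measurableT_comp mh mphi)|exact: (measurableT_comp mk mphi)].
have hkC (w : borel Omega) : `|h (freq (proj w)) - k (freq (proj w))| <= C + C.
  by apply: le_trans (ler_normB _ _) _; exact: lerD.
rewrite -RintegralB//; apply: le_trans (le_normr_Rintegral _ _) _ => //.
  exact: (@integrableB _ _ _ _ _ _ (EFin \o _) (EFin \o _)).
apply: le_trans (Rintegral_abs_le_norm2 (Lfun2_bounded mu mhk hkC)).
apply: le_Rintegral => //.
- have := integrableB measurableT ih ik => /integrable_abse.
  by apply: eq_integrable.
- apply: (@probability_integrable _ _ _ _ _ _ (C + C)) => //.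
    exact: measurableT_comp.
  by move=> w; rewrite normr_id.
- move=> w _; rewrite -mulrBr -mulrBl normrM normr_nat -[leRHS]mul1r.
  rewrite ler_pM// ?lern1 ?leq_b1// normrM -[leRHS]mulr1 ler_pM//; exact: cos_max.
Qed.

Definition vanishing (h : R -> R) := forall a, osc h t a @[t --> +oo] --> 0.

Lemma vanishing_lim (h_ : nat -> R -> R) (h : R -> R) (C : R) :
  (forall m, measurable_fun setT (h_ m)) -> (forall m x, `|h_ m x| <= C) ->
  (forall x, h_ ^~ x @ \oo --> h x) -> (forall m, vanishing (h_ m)) ->
  vanishing h.
Proof.
move=> mh_ h_C h_h v a.
have mh : measurable_fun setT h by apply: (measurable_fun_cvg mh_) => x _; exact: h_h.
have hC x : `|h x| <= C.
  have c : `|h_ m x| @[m --> \oo] --> `|h x| by apply: cvg_norm; exact: h_h.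
  rewrite -(cvg_lim _ c)//.
  by apply: limr_le; [exact: cvgP c|exact: nearW].
have [_ N0] : (fun w => h (freq (proj w))) \in Lfun mu 2%:E /\
    norm2 mu (fun w => h_ m (freq (proj w)) - h (freq (proj w))) @[m --> \oo] --> 0.
  apply: (norm2_dominated_cvg (G := cst C)) => [|m|x|m x] /=.
  - by apply: (@Lfun2_bounded _ _ _ _ _ `|C|).
  - exact: (measurableT_comp (mh_ m) mphi).
  - exact: h_h.
  - exact: h_C.
apply/cvgr0Pnorm_le => e e0.
have e2 : 0 < e / 2 by rewrite divr_gt0.
move/cvgr0Pnorm_le : N0 => /(_ _ e2)[m _ /(_ m (leqnn _))/= Nm].
have := v m a => /cvgr0Pnorm_le /(_ _ e2); apply: filterS => t ot.
rewrite -(subrK (osc (h_ m) t a) (osc h t a)) (splitr e).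
apply: le_trans (ler_normD _ _) (lerD _ ot).
rewrite distrC; apply: le_trans (osc_dist t a (mh_ m) mh (h_C m) hC) _.
exact: le_trans (ler_norm _) Nm.
Qed.

Lemma osc_sin (h : R -> R) (C : R) s t a : measurable_fun setT h ->
  (forall x, `|h x| <= C) ->
  osc (fun z => h z * sin (pi * s * z)) t a =
  2^-1 * (osc h (t + s / 2) (a - pi / 2) - osc h (t - s / 2) (a - pi / 2)).
Proof.
move=> mh hC.
have i1 := osc_integrable mu F hU xi (t + s / 2) (a - pi / 2) mh hC.
have i2 := osc_integrable mu F hU xi (t - s / 2) (a - pi / 2) mh hC.
rewrite -RintegralB// -RintegralZl//; last first.
  exact: (@integrableB _ _ _ _ _ _ (EFin \o _) (EFin \o _)).
apply: eq_Rintegral => w _; set z := freq _.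
rewrite -mulrBr -mulrBr !addrA !cosBpihalf.
have -> : 2 * pi * (t + s / 2) * z + a = (2 * pi * t * z + a) + pi * s * z by field.
have -> : 2 * pi * (t - s / 2) * z + a = (2 * pi * t * z + a) - pi * s * z by field.
by rewrite sinB sinD; field.
Qed.

Hypothesis mu_compat : compatible_measure B mu.
Hypothesis shear : keplerian_shear mu g.
Hypothesis xi0 : xi != 0.

(** By [ip_wave_osc] the oscillation is twice the correlation of two waves, and shear makes
    correlations converge; the value of the limit is left unknown. *)
Lemma osc_limit (h : R -> R) (C : R) a : measurable_fun setT h ->
  (forall x, `|h x| <= C) -> exists l : R, osc h t a @[t --> +oo] --> l.
Proof.
move=> mh hC.
have hC1 x : `|h x| <= Num.max 1 C by rewrite le_max hC orbT.
have mr := rot_measurable F hU xi.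
have mhr : measurable_fun setT (fun x => h (freq x) * rotating F U xi x).
  by apply: measurable_funM => //; exact: (measurableT_comp mh (freq_measurable F hU xi)).
have hrC x : `|h (freq x) * rotating F U xi x| <= C.
  by rewrite normrM -[leRHS]mulr1 ler_pM//; exact: rot_le1.
have wL : wave B U xi (fun x => h (freq x) * rotating F U xi x) (cst a) \in Lfun mu 2%:E.
  apply: (@Lfun2_bounded _ _ _ _ _ C); first exact: wave_measurable.
  by move=> w; exact: wave_le.
have kL : wave B U xi (rotating F U xi) (cst 0) \in Lfun mu 2%:E.
  apply: (@Lfun2_bounded _ _ _ _ _ 1); first exact: wave_measurable.
  by move=> w; apply: wave_le => x; exact: rot_le1.
have [f _ [_ _ /(_ _ kL) c]] := shear wL.
exists (2 * inner mu f (wave B U xi (rotating F U xi) (cst 0))).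
apply: cvg_trans (cvgM (cvg_cst (2 : R)) c); apply: near_eq_cvg; apply: nearW => t /=.
rewrite -[X in 2 * X]/(inner mu (wave B U xi (fun x => h (freq x) * rotating F U xi x) (cst a) \o g t)
  (wave B U xi (rotating F U xi) (cst 0))).
rewrite (@ip_wave_osc _ _ _ _ _ _ _ _ _ F _ hU _ mu_compat h (Num.max 1 C))//.
  by rewrite subr0 mulrA divff// mul1r.
by rewrite le_max lexx.
Qed.

Lemma vanishing_sin (h : R -> R) (C : R) s : measurable_fun setT h ->
  (forall x, `|h x| <= C) -> vanishing (fun z => h z * sin (pi * s * z)).
Proof.
move=> mh hC a; have [l c] := osc_limit (a - pi / 2) mh hC.
have cp : osc h (t + s / 2) (a - pi / 2) @[t --> +oo] --> l.
  by rewrite (cvg_shiftr (s / 2) (fun t => osc h t (a - pi / 2))).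
have cm : osc h (t - s / 2) (a - pi / 2) @[t --> +oo] --> l.
  by rewrite (cvg_centerr (s / 2) (fun t => osc h t (a - pi / 2))).
rewrite [X in _ --> X](_ : 0 = 2^-1 * (l - l)); last by rewrite subrr mulr0.
apply: cvg_trans (cvgM (cvg_cst (2^-1 : R)) (cvgB cp cm)); apply: near_eq_cvg; apply: nearW => t /=.
by rewrite (osc_sin _ _ _ mh hC).
Qed.

Lemma vanishing_sin_neq0 s : vanishing (fun z => (sin (pi * s * z) != 0)%:R).
Proof.
pose S z : R := sin (pi * s * z).
have cS : continuous S.
  by move=> z; apply: continuous_comp; [exact: mulrl_continuous|exact: continuous_sin].
have e0 m z : 0 < S z ^+ 2 + m.+1%:R^-1 by rewrite ltr_wpDl ?sqr_ge0// invr_gt0.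
(* A regularized inverse of [S]: each [h_ m] is bounded, by [m + 1], so [vanishing_sin] applies,
   while [h_ m * S] stays in [0, 1] and tends to the indicator of [S != 0]. *)
pose h_ m z := S z / (S z ^+ 2 + m.+1%:R^-1).
have ch m : measurable_fun setT (h_ m).
  apply: continuous_measurable_fun => z; apply: cvgM; first exact: cS.
  apply: cvgV; first by rewrite gt_eqF.
  apply: cvgD; last exact: cvg_cst.
  exact: (continuous_comp (cS z) (@exprn_continuous R 2 _)).
have S1 z : `|S z| <= 1 by exact: sin_max.
have hle m z : `|h_ m z| <= m.+1%:R.
  rewrite normrM normfV [`|_ + _|]gtr0_norm// ler_pdivrMr//.
  by rewrite (le_trans (S1 z))// mulrDr divff// lerDr mulr_ge0// sqr_ge0.
have mhS m : measurable_fun setT (fun z => h_ m z * S z).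
  by apply: measurable_funM => //; exact: continuous_measurable_fun.
apply: (@vanishing_lim (fun m z => h_ m z * S z) _ 1) => //.
- move=> m z; rewrite /h_ mulrAC -expr2 normrM normfV [`|_ + _|]gtr0_norm//.
  by rewrite ler_pdivrMr// mul1r ger0_norm ?sqr_ge0// lerDl invr_ge0.
- move=> z; rewrite -/(S z); have [->|z0] := eqVneq (S z) 0.
    by under eq_fun do rewrite mulr0; exact: cvg_cst.
  rewrite /= /h_; under eq_fun do rewrite mulrAC -expr2.
  have -> : (true%:R : R) = S z ^+ 2 / S z ^+ 2 by rewrite divff ?sqrf_eq0.
  apply: cvgM; first exact: cvg_cst.
  apply: cvgV; first by rewrite sqrf_eq0.
  rewrite -[X in _ --> X]addr0; apply: cvgD; [exact: cvg_cst|exact: cvg_harmonic].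
- by move=> m; exact: (vanishing_sin (C := m.+1%:R)).
Qed.

Lemma sin_neq0_pi (z : R) : z != 0 -> `|z| < pi -> sin z != 0.
Proof.
wlog z0 : z / 0 < z => [W zn0 zpi|_].
  have [z0|z0|z0] := ltgtP z 0; [|exact: W|by rewrite z0 eqxx in zn0].
  by rewrite -[z]opprK sinN oppr_eq0 W ?normrN ?oppr_eq0 ?oppr_gt0.
by rewrite gtr0_norm// => zpi; rewrite gt_eqF// sin_gt0_pi// z0.
Qed.

Lemma vanishing_cst1 : vanishing (cst 1).
Proof.
have ms (s : R) : measurable_fun setT (fun z : R => ((sin (pi * s * z) != 0)%:R : R)).
  apply: measurable_neq0; apply: continuous_measurable_fun => z.
  by apply: continuous_comp; [exact: mulrl_continuous|exact: continuous_sin].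
have v : vanishing (fun z => (z != 0)%:R).
  (* Once [m] exceeds [|z|], the angle [pi z / (m + 1)] lies strictly between [- pi] and [pi], where
     the sine vanishes only at 0. *)
  apply: (@vanishing_lim (fun m z => (sin (pi * m.+1%:R^-1 * z) != 0)%:R) _ 1) => //.
  - by move=> m z; rewrite normr_nat lern1 leq_b1.
  - move=> z; apply: cvg_near_cst; have [->|z0] := eqVneq z 0.
      by apply: nearW => m; rewrite mulr0 sin0 eqxx.
    apply: filterS (nbhs_infty_gtr `|z|) => m zm.
    have m0 : 0 < m.+1%:R :> R by [].
    suff -> : sin (pi * m.+1%:R^-1 * z) != 0 by [].
    apply: sin_neq0_pi; first by rewrite !mulf_neq0 ?invr_eq0// gt_eqF ?pi_gt0.
    rewrite !normrM gtr0_norm ?pi_gt0// -mulrA gtr_pMr ?pi_gt0// normfV normr_nat.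
    by rewrite mulrC ltr_pdivrMr// mul1r (lt_trans zm)// ltr_nat.
  - by move=> m; exact: vanishing_sin_neq0.
(* The integrand of an oscillation already contains the factor [freq != 0], so this amplitude and
   the constant 1 give the same value. *)
move=> a; apply: cvg_trans (v a); apply: near_eq_cvg; apply: nearW => t.
by apply: eq_Rintegral => w _; case: eqVneq => //; rewrite !mul0r.
Qed.

Lemma keplerian_shear_rajchman :
  rajchman (restriction (frequency_measure F mu hU xi) (measurable_nonzero R)).
Proof. by apply/rajchman_osc => a _; exact: vanishing_cst1. Qed.

End shear_to_rajchman.

(** * The Rajchman property implies shear *)

Section rajchman_to_shear.
Import HBNNSimple.
Context (R : realType) (n d : nat) (M Omega : ptopologicalType).
Context (X : C1_manifold R n M) (B : tori_bundle d Omega X).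
Context (mu : probability (borel Omega) R) (g : R -> Omega -> Omega).
Context (F : compatible_flow B g).
Hypothesis mu_compat : compatible_measure B mu.
Hypothesis mpf : @measure_preserving_flow _ (borel Omega) R mu g.

Local Notation proj := (bundle_proj B).
Local Notation ip := (inner mu).
Local Notation L2 := (Lfun mu 2%:E).

Lemma Lfun2_mul_bounded (h f : borel Omega -> R) (C : R) : measurable_fun setT h ->
  (forall x, `|h x| <= C) -> f \in L2 -> (fun x => h x * f x) \in L2.
Proof.
move=> mh hC /Lfun2P[mf f2]; apply/Lfun2P; split; first exact: measurable_funM.
apply: (le_integrable measurableT _ _ (integrableZl measurableT (C ^+ 2) f2)).
  by apply/measurable_EFinP; apply: measurable_funX; exact: measurable_funM.
move=> x _ /=; rewrite lee_fin exprMn !normrM ler_wpM2r//.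
by rewrite ler_pM// (le_trans (hC x))// ler_norm.
Qed.

Lemma invariant_limit_of_invariant f : f \in L2 -> (forall t, f \o g t = f) ->
  invariant_limit mu g f f.
Proof. by move=> fL fi; split => // k kL; under eq_fun do rewrite fi; exact: cvg_cst. Qed.

Lemma invariant_limit_cst0 f : f \in L2 ->
  (forall k, k \in L2 -> ip (f \o g t) k @[t --> +oo] --> 0) -> invariant_limit mu g f (cst 0).
Proof.
move=> fL f0; split => //; first by apply: (@Lfun2_bounded _ _ _ _ _ 0) => // x; rewrite normr0.
move=> k kL; rewrite [X in _ --> X](_ : _ = 0); first exact: f0.
by rewrite /inner; under eq_Rintegral do rewrite mul0r; rewrite /Rintegral integral0.
Qed.

Section chart.
Context (U : set M) (hU : atlas X U) (xi : 'rV[int]_d).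

Local Notation freq := (chart_frequency F U xi).
Local Notation rot := (rotating F U xi).

Lemma wave_Lfun2 (h b : borel M -> R) (C : R) : measurable_fun setT h ->
  (forall x, `|h x| <= C) -> measurable_fun setT b -> wave B U xi h b \in L2.
Proof.
move=> mh hC mb; apply: (@Lfun2_bounded _ _ _ _ _ C).
  by apply: wave_measurable => //; exact: measurable_funTS.
by move=> w; exact: wave_le.
Qed.

Lemma wave_invariant (h : borel M -> R) a t : (forall x, freq x != 0 -> h x = 0) ->
  wave B U xi h (cst a) \o g t = wave B U xi h (cst a).
Proof.
move=> h0; rewrite (wave_freq_flow F)//; apply/funext => w; rewrite /wave.
have [f0|/h0->] := eqVneq (freq (proj w)) 0; last by rewrite !mul0r.
by rewrite f0 mulr0 add0r.
Qed.

(** In the self-correlation at lag [t] the constant phases cancel, leaving half of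
    [oscillation (cst 1) t 0], the real part of a Fourier transform that decays. *)
Lemma rot_wave_weak_null a : xi != 0 ->
  rajchman (restriction (frequency_measure F mu hU xi) (measurable_nonzero R)) ->
  forall k, k \in L2 -> ip (wave B U xi rot (cst a) \o g t) k @[t --> +oo] --> 0.
Proof.
move=> xi0 /rajchman_osc/(_ 0 (or_introl erefl)) raj k kL.
have fL : wave B U xi rot (cst a) \in L2.
  by apply: (wave_Lfun2 (C := 1)) => //; [exact: rot_measurable|exact: rot_le1].
apply: (weak_null_flow mpf) => //.
rewrite [X in _ --> X](_ : 0 = 2^-1 * 0); last by rewrite mulr0.
apply: cvg_trans (cvgM (cvg_cst (2^-1 : R)) raj); apply: near_eq_cvg; apply: nearW => t /=.
have E := ip_wave_osc F hU mu_compat a a t xi0 (lexx 1) (measurable_cst (1 : R)).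
rewrite subrr in E; rewrite -E; last by move=> x; rewrite normr1.
congr (ip (wave B U xi _ (cst a) \o g t) _); apply/funext => x.
by rewrite /= mul1r.
Qed.

Lemma wave_invariant_limit (h : borel M -> R) a (C : R) :
  (xi != 0 -> rajchman (restriction (frequency_measure F mu hU xi) (measurable_nonzero R))) ->
  measurable_fun setT h -> (forall x, `|h x| <= C) ->
  exists k, invariant_limit mu g (wave B U xi h (cst a)) k.
Proof.
move=> raj mh hC; have [xi0|xi0] := eqVneq xi 0.
  exists (wave B U xi h (cst a)); apply: invariant_limit_of_invariant.
    exact: (wave_Lfun2 (C := C)).
  move=> t; apply: wave_invariant => x; rewrite /chart_frequency patchE; case: ifP => _; last by rewrite eqxx.
  rewrite /frequency /dotv big1 ?eqxx// => i _.
  by rewrite xi0 !mxE mul0r.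
have mr := rot_measurable F hU xi.
have rh (k : borel M -> R) : (forall x, `|k x| <= 1) -> forall x, `|h x * k x| <= C.
  by move=> k1 x; rewrite normrM -[leRHS]mulr1 ler_pM.
pose s x := 1 - rot x.
have ms : measurable_fun setT s by exact: measurable_funB.
have s1 x : `|s x| <= 1 by rewrite /s /rotating; case: (_ != _); rewrite ?subrr ?subr0 ?normr0 ?normr1.
have I1 : invariant_limit mu g (wave B U xi (h \* s) (cst a)) (wave B U xi (h \* s) (cst a)).
  apply: invariant_limit_of_invariant.
    by apply: (wave_Lfun2 (C := C)) => //; [exact: measurable_funM|exact: rh].
  move=> t; apply: wave_invariant => x x0.
  by rewrite /= /s /rotating x0 subrr mulr0.
have I2 : invariant_limit mu g (wave B U xi (h \* rot) (cst a)) (cst 0).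
  apply: invariant_limit_cst0.
    apply: (wave_Lfun2 (C := C)) => //; first exact: measurable_funM.
    by apply: rh; exact: rot_le1.
  move=> k kL.
  (* The factor [h (proj w)] is constant along orbits, so it passes to the test function and the
     amplitude reduces to [rot]. *)
  have hkL : (fun w => h (proj w) * k w) \in L2.
    by apply: (Lfun2_mul_bounded (C := C)) => //; exact: (measurableT_comp mh (mproj_measurable B)).
  apply: cvg_trans (rot_wave_weak_null a xi0 (raj xi0) hkL); apply: near_eq_cvg; apply: nearW => t.
  by apply: eq_Rintegral => w _; rewrite /= /wave (proj_flow F) /=; ring.
eexists; have := invariant_limitD mpf I1 I2; congr invariant_limit.
by apply/funext => w; rewrite /wave /s /=; ring.
Qed.

End chart.

Hypothesis raj : forall (U : set M) (hU : atlas X U) (xi : 'rV[int]_d), xi != 0 ->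
  rajchman (restriction (frequency_measure F mu hU xi) (measurable_nonzero R)).

Local Notation good f := (exists k, invariant_limit mu g f k).

Lemma eq_good f k : f = k -> good k -> good f.
Proof. by move=> ->. Qed.

Lemma good_lim (f_ : nat -> borel Omega -> R) f G : (forall m, good (f_ m)) -> G \in L2 ->
  (forall x, f_ ^~ x @ \oo --> f x) -> (forall m x, `|f_ m x| <= G x) -> good f.
Proof.
move=> gf GL ff fG.
have mf m : measurable_fun setT (f_ m) by have [k [/Lfun2_measurable]] := gf m.
by have [fL N0] := norm2_dominated_cvg GL mf ff fG; exact: (invariant_limit_closed mpf gf).
Qed.

Lemma goodD f k : good f -> good k -> good (fun x => f x + k x).
Proof. by move=> [f' If] [k' Ik]; eexists; exact: (invariant_limitD mpf If Ik). Qed.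

Lemma goodZ c f : good f -> good (fun x => c * f x).
Proof. by move=> [f' If]; eexists; exact: (invariant_limitZ mpf c If). Qed.

Lemma bounded_closure_good U (hU : atlas X U) f : bounded_closure (waves B U) f -> good f.
Proof.
elim=> {f} [f|f k _ If _ Ik|c f _ If|f_ f C _ If fC ff].
- move=> [xi [h [a [C [mh hC ->]]]]].
  by apply: (wave_invariant_limit _ _ mh hC) => xi0; exact: (raj hU).
- exact: goodD.
- exact: goodZ.
- apply: (good_lim (G := cst C) If _ ff fC).
  by apply: (@Lfun2_bounded _ _ _ _ _ `|C|).
Qed.

Lemma good0 : good (fun=> 0).
Proof.
exists (fun=> 0); apply: invariant_limit_of_invariant => //.
by apply: (@Lfun2_bounded _ _ _ _ _ 0) => // x; rewrite normr0.
Qed.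

Hypothesis M_lindelof : lindelof M.

Lemma indic_good (E : set (borel Omega)) : measurable E -> good (\1_E : borel Omega -> R).
Proof.
have [G [Gat /countable_injP[f fi] Gcov]] := M_lindelof (@atlas_open _ _ _ X) (atlas_cover X).
(* The part of the bundle over the chart numbered [k] in a countable subcover, empty when no chart
   has that number. *)
pose W k : set (borel Omega) := [set w | exists V, [/\ G V, f V = k & V (proj w)]].
have WP k : W k = set0 \/ exists2 V, atlas X V & W k = proj @^-1` V.
  have [[V [GV fV]]|nV] := pselect (exists V, G V /\ f V = k); last first.
    by left; apply/seteqP; split => // w [V [GV fV _]]; apply: nV; exists V.
  right; exists V; first exact: Gat.
  apply/seteqP; split => w; last by move=> Vw; exists V.
  by move=> [V' [GV' fV' V'w]]; rewrite (fi V V') ?inE// fV.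
have mW k : measurable (W k).
  by case: (WP k) => [->//|[V hV ->]]; exact: preimage_atlas_measurable.
have gW A k : measurable A -> good (\1_(A `&` W k) : borel Omega -> R).
  move=> mA; case: (WP k) => [->|[V hV ->]]; first by rewrite setI0 indic0; exact: good0.
  by apply: (bounded_closure_good hV); exact: waves_closure_set.
pose D := fix D k := if k is k'.+1 then D k' `|` W k' else set0 : set (borel Omega).
have mD k : measurable (D k) by elim: k => //= k IH; exact: measurableU.
have gD A k : measurable A -> good (\1_(A `&` D k) : borel Omega -> R).
  move=> mA; elim: k => [|k IH] /=; first by rewrite setI0 indic0; exact: good0.
  (* Removing [D k] from [A] before cutting by [W k] makes the pieces disjoint, so that their
     indicators add up. *)
  apply: eq_good (goodD IH (gW _ k (measurableD mA (mD k)))).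
  apply/funext => x; rewrite !indicE setDE !in_setI in_setC in_setU.
  by case: (x \in A); case: (x \in D k); case: (x \in W k) => /=; rewrite ?addr0 ?add0r.
have WD k m : (k < m)%N -> W k `<=` D m.
  elim: m => //= m IH; rewrite ltnS leq_eqVlt => /predU1P[->|/IH]; first exact: subsetUr.
  by move=> kD; apply: subset_trans kD _; exact: subsetUl.
move=> mE; apply: (good_lim (G := cst 1) (fun m => gD E m mE)).
- by apply: (@Lfun2_bounded _ _ _ _ _ 1) => // x; rewrite normr1.
- move=> x; apply: cvg_near_cst.
  have [V GV Vx] : (\bigcup_(V in G) V) (proj x) by rewrite Gcov.
  exists (f V).+1 => // m /= fm; rewrite !indicE in_setI.
  rewrite (_ : x \in D m) ?andbT//; apply/mem_set.
  by apply: (WD (f V)) => //; exists V.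
- by move=> m x; rewrite indicE normr_nat lern1 leq_b1.
Qed.

Lemma good_sum (I : Type) (r : seq I) (f_ : I -> borel Omega -> R) :
  (forall i, good (f_ i)) -> good (fun x => \sum_(i <- r) f_ i x).
Proof.
move=> gf; elim: r => [|i r IH].
  by apply: eq_good good0; apply/funext => x; rewrite big_nil.
by apply: eq_good (goodD (gf i) IH); apply/funext => x; rewrite big_cons.
Qed.

(** Simple functions increase to a nonnegative [k], which itself serves as the dominating
    function. *)
Lemma Lfun2_good f : f \in L2 -> good f.
Proof.
suff H (k : borel Omega -> R) : k \in L2 -> (forall x, 0 <= k x) -> good k.
  move=> fL; have mf := Lfun2_measurable fL.
  pose A := f @^-1` `]0, +oo[.
  have mA : measurable A by rewrite -[A]setTI; exact: mf.
  have g1 : good (fun x => \1_A x * f x).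
    apply: H => [|x].
      apply: (Lfun2_mul_bounded (C := 1)) => // x.
      by rewrite indicE normr_nat lern1 leq_b1.
    rewrite indicE; case: (boolP (x \in A)) => [/set_mem|]; last by rewrite mul0r.
    by rewrite /A /= in_itv/= andbT mul1r => /ltW.
  (* [(\1_A x - 1) * f x] is the negative part of [f]. *)
  have g2 : good (fun x => (\1_A x - 1) * f x).
    apply: H => [|x].
      apply: (Lfun2_mul_bounded (C := 1)) => // [|x]; first exact: measurable_funB.
      by rewrite indicE; case: (x \in A); rewrite ?subrr ?sub0r ?normrN ?normr0 ?normr1.
    rewrite indicE; case: (boolP (x \in A)) => [_|/negP xA]; first by rewrite subrr mul0r.
    rewrite sub0r mulN1r oppr_ge0 leNgt; apply/negP => f0.
    by apply: xA; apply/mem_set; rewrite /A /= in_itv/= andbT.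
  apply: eq_good (goodD g1 (goodZ (-1) g2)).
  by apply/funext => x; ring.
move=> kL k0; have mk : measurable_fun setT (EFin \o k).
  by apply/measurable_EFinP; exact: Lfun2_measurable kL.
pose s := nnsfun_approx measurableT mk.
have sk x : s ^~ x @ \oo --> k x.
  have := @cvg_nnsfun_approx _ _ _ _ measurableT _ mk _ x I.
  by move=> /(_ (fun x _ => k0 x))/fine_cvgP[_].
have sle m x : s m x <= k x.
  have nds : nondecreasing_seq (s ^~ x).
    by move=> i j ij; have /lefP := nd_nnsfun_approx measurableT mk ij; exact.
  rewrite -(cvg_lim _ (sk x))//; apply: nondecreasing_cvgn_le => //.
  exact: cvgP (sk x).
apply: (good_lim (f_ := s) (G := k)) => //; last by move=> m x; rewrite ger0_norm.
move=> m; apply: eq_good (good_sum (finmap.enum_fset (fset_set (range (s m))))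
    (f_ := fun y x => y * \1_(s m @^-1` [set y]) x) _).
  by apply/funext => x; rewrite fimfunE fsbig_finite.
by move=> y; apply: goodZ; apply: indic_good; exact: measurable_sfunP.
Qed.

Lemma rajchman_keplerian_shear : @keplerian_shear _ (borel Omega) R mu g.
Proof. by apply: (keplerian_shear_of_invariant_limit mpf); exact: Lfun2_good. Qed.

End rajchman_to_shear.

Theorem theorem4p2 (R : realType) (n d : nat) (M Omega : ptopologicalType)
    (X : C1_manifold R n M) (B : tori_bundle d Omega X)
    (mu : probability (borel Omega) R) (g : R -> Omega -> Omega)
    (F : compatible_flow B g) :
  (0 < d)%N -> lindelof M ->
  compatible_measure B mu ->
  @measure_preserving_flow _ (borel Omega) R mu g ->
  @keplerian_shear _ (borel Omega) R mu g <->
  forall (U : set M) (hU : atlas X U) (xi : 'rV[int]_d), xi != 0 ->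
    rajchman (restriction (frequency_measure F mu hU xi)
                (measurable_nonzero R)).
Proof.
move=> d0 M_lindelof mu_compat mpf; split=> [shear U hU xi xi0|raj].
  exact: keplerian_shear_rajchman.
exact: (rajchman_keplerian_shear mu_compat mpf raj M_lindelof).
Qed.
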